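(* Let $X$ be a $\mathcal{VH}$ square complex in which each vertical edge is adjacent to finitely many squares, and let $X^*$ be its simplexification. Then $X$ and $X^*$ have the same homotopy type.
   Context: Square complexes: a (generalised) square complex is obtained from a set of vertices, edges and squares by gluing along affine embeddings of cells onto faces of cells (closed under composition), with precisely one attaching map onto each proper face of each cell; cells need not be embedded (e.g. an edge may be a loop, or two sides of a square may be glued together). A $\mathcal{VH}$-complex is a square complex whose edges are partitioned into two classes, vertical and horizontal, such that going around the boundary of each square the sides alternate between vertical and horizontal. A generalised simplicial complex is a set of affine simplices together with a set, closed under composition, of affine embeddings (attaching maps) of simplices onto faces of simplices, such that for each proper face of each simplex there is precisely one attaching map onto it; the geometric realisation is the quotient (simplices need not be embedded). Simplexification: let $X$ be a $\mathcal{VH}$-complex with vertex set $V$, set of vertical edges $E_V$ and set of squares $S$. Divide each vertical edge $e\in E_V$ in two by a new vertex $e^*$; the boundary of each square $s$ then becomes a hexagon, and $s$ is subdivided into six triangles by coning this hexagon from a new vertex $s^*$ in its interior. This gives a generalised simplicial complex $\hat X$ triangulating $X$, with vertices $v^*$ ($v\in V$), $e^*$ ($e\in E_V$), $s^*$ ($s\in S$). For $e\in E_V$ with endpoints $v_+,v_-$ (possibly equal), let $s_1,\dots,s_n$ be the squares adjacent to $e$, counted with multiplicity (a square both of whose vertical sides are $e$ is listed twice). The complex $X^*$ is obtained from $\hat X$ by attaching, for each $e\in E_V$, two simplices $\sigma^+=v_+^*e^*s_1^*\cdots s_n^*$ and $\sigma^-=v_-^*e^*s_1^*\cdots s_n^*$.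 They are glued to each other along their common face $e^*s_1^*\cdots s_n^*$, and for each $i$ their faces $v_\pm^*e^*s_i^*$ are glued to the corresponding two triangles of $\hat X$ containing $e^*$ inside the (occurrence of the) square $s_i$; no further identifications are made except those forced by these. Thus the link of $e^*$ in $\hat X$ is the suspension of $n$ points, whereas in $X^*$ it is the suspension of an $(n-1)$-simplex, and the union of the simplices of $X^*$ containing $e^*$ is the suspension of an $n$-simplex with some pairs of vertices possibly identified. *)

(* Defs.v *)
From HB Require Import structures.
From mathcomp Require Import all_boot all_order all_algebra finmap.
From mathcomp Require Import generic_quotient.
From mathcomp Require Import all_classical all_reals all_analysis.
From Stdlib Require Import Relation_Operators.
From Stdlib Require List.
Import Order.TTheory GRing.Theory Num.Theory.
Import numFieldNormedType.Exports.

Set Implicit Arguments.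
Unset Strict Implicit.
Unset Printing Implicit Defensive.

Local Open Scope classical_set_scope.
Local Open Scope ring_scope.
Local Open Scope quotient_scope.

Definition homotopic (R : realType) (T U : topologicalType) (f g : T -> U) :
    Prop :=
  exists H : T * R -> U,
    [/\ {within [set: T] `*` `[0, 1], continuous H},
        forall x, H (x, 0) = f x & forall x, H (x, 1) = g x].

Definition homotopy_equivalent (R : realType) (T U : topologicalType) : Prop :=
  exists (f : T -> U) (g : U -> T),
    [/\ continuous f, continuous g,
        homotopic R (g \o f) id & homotopic R (f \o g) id].

(* [attach c] is the set of attaching maps into the cell [c], each paired with
   the cell it comes from.  The realisation is the disjoint union of the cells
   modulo the equivalence relation generated by x ~ f x, with the quotient
   topology. *)

Record gluing (R : realType) := Gluing {
  cell : choiceType;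
  coord : cell -> finType;
  body : forall c, set {ptws coord c -> R};
  attach : forall c, set {c' : cell & {ptws coord c' -> R} -> {ptws coord c -> R}}
}.
Arguments body {R} g c.
Arguments attach {R} g c.

Definition cell_point (R : realType) (G : gluing R) : Type :=
  {c : cell G & set_type (body G c)}.

HB.instance Definition _ (R : realType) (G : gluing R) :=
  Topological.copy (cell_point G) {c : cell G & set_type (body G c)}.

Definition glued (R : realType) (G : gluing R) (x y : cell_point G) : Prop :=
  exists2 f, attach G (projT1 y) (existT _ (projT1 x) f) &
    f (set_val (projT2 x)) = set_val (projT2 y).

Definition glue_rel (R : realType) (G : gluing R) : rel (cell_point G) :=
  fun x y => `[< clos_refl_sym_trans _ (@glued R G) x y >].

Lemma glue_rel_refl (R : realType) (G : gluing R) : reflexive (@glue_rel R G).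
Proof. by move=> x; apply/asboolP; exact: rst_refl. Qed.

Lemma glue_rel_sym (R : realType) (G : gluing R) : symmetric (@glue_rel R G).
Proof. by move=> x y; apply/asboolP/asboolP; exact: rst_sym. Qed.

Lemma glue_rel_trans (R : realType) (G : gluing R) : transitive (@glue_rel R G).
Proof.
by move=> y x z /asboolP xy /asboolP yz; apply/asboolP; exact: rst_trans xy yz.
Qed.

Definition glue_equiv (R : realType) (G : gluing R) :=
  EquivRel (@glue_rel R G) (@glue_rel_refl R G) (@glue_rel_sym R G)
    (@glue_rel_trans R G).

Definition glue_quot (R : realType) (G : gluing R) := {eq_quot (glue_equiv G)}.

Definition realisation (R : realType) (G : gluing R) : topologicalType :=
  quotient_topology (glue_quot G).

(* Each edge is a copy of [0,1]; its end [false] (resp. [true]) is 0 (resp. 1).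
   Each square is a copy of [0,1]^2, whose coordinates are indexed by [bool].
   The side (d, b) of a square is the one on which coordinate [d] equals [b];
   it is parametrised by the other coordinate.  The edge [side s d b] is
   attached to that side by the identity of [0,1] if [flip s d b] is [false],
   and by t |-> 1 - t otherwise, so that the end [c (+) flip s d b] of the edge
   is sent to the corner where the other coordinate equals [c]. *)

Record square_complex := SquareComplex {
  vertex : choiceType;
  edge : choiceType;
  square : choiceType;
  endpoint : edge -> bool -> vertex;
  side : square -> bool -> bool -> edge;
  flip : square -> bool -> bool -> bool;
  (* each corner of a square has a single attaching map: both sides through the
     corner induce the same one *)
  corner_compat : forall s x y,
    endpoint (side s false x) (y (+) flip s false x) =
    endpoint (side s true y) (x (+) flip s true y)
}.

Definition corner (X : square_complex) (s : square X) (p : bool * bool) :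
    vertex X :=
  endpoint (side s false p.1) (p.2 (+) flip s false p.1).

(* the corner of the side (d, b) where the other coordinate equals [c] *)
Definition side_corner (d b c : bool) : bool * bool :=
  if d then (c, b) else (b, c).

Lemma corner_side (X : square_complex) (s : square X) (d b c : bool) :
  corner s (side_corner d b c) = endpoint (side s d b) (c (+) flip s d b).
Proof. by case: d => //; rewrite /corner /side_corner corner_compat. Qed.

Inductive sq_cell (X : square_complex) :=
| VertexCell of vertex X
| EdgeCell of edge X
| SquareCell of square X.

HB.instance Definition _ (X : square_complex) := gen_eqMixin (sq_cell X).
HB.instance Definition _ (X : square_complex) := gen_choiceMixin (sq_cell X).

Definition sq_coord (X : square_complex) (c : sq_cell X) : finType :=
  match c with
  | VertexCell _ => void
  | EdgeCell _ => unit
  | SquareCell _ => bool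
  end.

Definition cube (R : realType) (K : finType) : set {ptws K -> R} :=
  [set x | forall k, 0 <= x k <= 1].

Definition end_map (R : realType) (b : bool) :
    {ptws void -> R} -> {ptws unit -> R} :=
  fun _ _ => b%:R.

Definition side_map (R : realType) (d b fl : bool) :
    {ptws unit -> R} -> {ptws bool -> R} :=
  fun t k => if k == d then b%:R else if fl then 1 - t tt else t tt.

Definition corner_map (R : realType) (p : bool * bool) :
    {ptws void -> R} -> {ptws bool -> R} :=
  fun _ k => if k then p.2%:R else p.1%:R.

Definition sq_attach (R : realType) (X : square_complex) (c : sq_cell X) :
    set {c' : sq_cell X & {ptws sq_coord c' -> R} -> {ptws sq_coord c -> R}} :=
  match c with
  | VertexCell _ => set0
  | EdgeCell e =>
      [set p | exists b,
        p = existT _ (VertexCell (endpoint e b)) (@end_map R b)]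
  | SquareCell s =>
      [set p | exists d b,
        p = existT _ (EdgeCell (side s d b)) (@side_map R d b (flip s d b))]
      `|`
      [set p | exists v,
        p = existT _ (VertexCell (corner s v)) (@corner_map R v)]
  end.

Definition sq_gluing (R : realType) (X : square_complex) : gluing R :=
  Gluing (fun c => @cube R (sq_coord c)) (@sq_attach R X).

Record vh_complex := VHComplex {
  vh_square_complex :> square_complex;
  vertical : pred (edge vh_square_complex);
  (* the sides of a square which are adjacent to (d, b) are the (~~ d, b') *)
  alternating : forall (s : square vh_square_complex) (d b b' : bool),
    vertical (side s (~~ d) b') = ~~ vertical (side s d b)
}.

Definition vedge (X : vh_complex) := {e : edge X | vertical e}.
Definition hedge (X : vh_complex) := {e : edge X | ~~ vertical e}.

(* a vertical (resp. horizontal) side of a square, as a triple (s, d, b) *)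
Definition vside (X : vh_complex) :=
  {o : square X * bool * bool | vertical (side o.1.1 o.1.2 o.2)}.
Definition hside (X : vh_complex) :=
  {o : square X * bool * bool | ~~ vertical (side o.1.1 o.1.2 o.2)}.

Definition vside_edge (X : vh_complex) (o : vside X) : vedge X :=
  exist _ (side (val o).1.1 (val o).1.2 (val o).2) (valP o).
Definition hside_edge (X : vh_complex) (o : hside X) : hedge X :=
  exist _ (side (val o).1.1 (val o).1.2 (val o).2) (valP o).

Definition side_square (X : square_complex) (o : square X * bool * bool) :=
  o.1.1.
Definition side_flip (X : square_complex) (o : square X * bool * bool) :=
  flip o.1.1 o.1.2 o.2.
Definition side_end (X : square_complex) (o : square X * bool * bool)
    (c : bool) : bool * bool :=
  side_corner o.1.2 o.2 c.

(* A set of affine simplices, with a set of vertex maps which induce the attaching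
   maps.  It need not list every face: the axioms of a generalised simplicial
   complex are stated separately below. *)
Record simplicial_gluing := SimplicialGluing {
  simplex : choiceType;
  vtx : simplex -> finType;
  face_maps : forall s, set {t : simplex & vtx t -> vtx s}
}.
Arguments face_maps : clear implicits.

Definition generalised_simplicial_complex (K : simplicial_gluing) : Prop :=
  [/\ forall s : simplex K, [set: vtx s] !=set0,
      forall (s : simplex K) p, face_maps K s p ->
        injective (projT2 p) /\ range (projT2 p) != setT,
      forall (s : simplex K) p q, face_maps K s p ->
        face_maps K (projT1 p) q ->
        face_maps K s (existT _ (projT1 q) (projT2 p \o projT2 q)) &
      forall (s : simplex K) (A : set (vtx s)), A !=set0 -> A != setT ->
        exists! p, face_maps K s p /\ range (projT2 p) = A].

Definition std_simplex (R : realType) (K : finType) : set {ptws K -> R} :=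
  [set w | (forall k, 0 <= w k) /\ \sum_k w k = 1].

Definition simplex_map (R : realType) (K L : finType) (f : K -> L) :
    {ptws K -> R} -> {ptws L -> R} :=
  fun w l => \sum_(k | f k == l) w k.

Definition simp_gluing (R : realType) (K : simplicial_gluing) : gluing R :=
  @Gluing R (simplex K) (@vtx K) (fun s => @std_simplex R (vtx s))
    (fun s => [set existT _ (projT1 p) (simplex_map (R := R) (projT2 p)) |
               p in face_maps K s]).

(* The triangulation X^ of X, where e^* is the midpoint of a vertical edge e and
   s^* is the centre of a square s. *)

Inductive hat_simplex (X : vh_complex) :=
| HatVertex of vertex X              (* v^* *)
| HatMid of vedge X                  (* e^* *)
| HatCentre of square X              (* s^* *)
| HatHEdge of hedge X                (* a horizontal edge *)
| HatHalf of vedge X & bool          (* the half of e at its end b *)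
| HatCornerSpoke of square X & bool * bool      (* from a corner to s^* *)
| HatMidSpoke of vside X             (* from the midpoint of a side to s^* *)
| HatHTriangle of hside X            (* the cone on a horizontal side *)
| HatVTriangle of vside X & bool.    (* the cone on the half of a vertical side
                                        where the other coordinate is near c *)

HB.instance Definition _ (X : vh_complex) := gen_eqMixin (hat_simplex X).
HB.instance Definition _ (X : vh_complex) := gen_choiceMixin (hat_simplex X).

(* Vertices of the simplices:
   - HatHEdge: the two ends of the edge;
   - HatHalf: [false] is the end of e, [true] is e^*;
   - spokes: [false] is on the boundary of the square, [true] is s^*;
   - HatHTriangle: [Some c] is the corner where the other coordinate is c,
     [None] is s^*;
   - HatVTriangle: [Some false] is the corner, [Some true] is e^*, [None] is
     s^*. *)
Definition hat_vtx (X : vh_complex) (s : hat_simplex X) : finType :=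
  match s with
  | HatVertex _ | HatMid _ | HatCentre _ => unit
  | HatHEdge _ | HatHalf _ _ | HatCornerSpoke _ _ | HatMidSpoke _ => bool
  | HatHTriangle _ | HatVTriangle _ _ => option bool
  end.

Definition hat_face (X : vh_complex) (K : finType) (t : hat_simplex X)
    (f : hat_vtx t -> K) : {t : hat_simplex X & hat_vtx t -> K} :=
  existT _ t f.

Definition spoke_map (k : bool) : bool -> option bool :=
  fun c => if c then None else Some k.

Definition hat_faces (X : vh_complex) (s : hat_simplex X) :
    seq {t : hat_simplex X & hat_vtx t -> hat_vtx s} :=
  match s with
  | HatVertex _ | HatMid _ | HatCentre _ => [::]
  | HatHEdge h =>
      [:: hat_face (t := HatVertex (endpoint (val h) false)) (fun=> false);
          hat_face (t := HatVertex (endpoint (val h) true)) (fun=> true)]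
  | HatHalf e b =>
      [:: hat_face (t := HatVertex (endpoint (val e) b)) (fun=> false);
          hat_face (t := HatMid e) (fun=> true)]
  | HatCornerSpoke s p =>
      [:: hat_face (t := HatVertex (corner s p)) (fun=> false);
          hat_face (t := HatCentre s) (fun=> true)]
  | HatMidSpoke o =>
      [:: hat_face (t := HatMid (vside_edge o)) (fun=> false);
          hat_face (t := HatCentre (side_square (val o))) (fun=> true)]
  | HatHTriangle o =>
      let s := side_square (val o) in
      let v c := side_end (val o) c in
      [:: hat_face (t := HatVertex (corner s (v false))) (fun=> Some false);
          hat_face (t := HatVertex (corner s (v true))) (fun=> Some true);
          hat_face (t := HatCentre s) (fun=> None);
          hat_face (t := HatHEdge (hside_edge o))
            (fun c => Some (c (+) side_flip (val o)));
          hat_face (t := HatCornerSpoke s (v false)) (spoke_map false);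
          hat_face (t := HatCornerSpoke s (v true)) (spoke_map true)]
  | HatVTriangle o c =>
      let s := side_square (val o) in
      let v := side_end (val o) c in
      [:: hat_face (t := HatVertex (corner s v)) (fun=> Some false);
          hat_face (t := HatMid (vside_edge o)) (fun=> Some true);
          hat_face (t := HatCentre s) (fun=> None);
          hat_face (t := HatHalf (vside_edge o) (c (+) side_flip (val o))) Some;
          hat_face (t := HatCornerSpoke s v) (spoke_map false);
          hat_face (t := HatMidSpoke o) (spoke_map true)]
  end.

Definition hat_complex (X : vh_complex) : simplicial_gluing :=
  SimplicialGluing (fun s : hat_simplex X => [set p | List.In p (hat_faces s)]).

Ltac in_list n :=
  lazymatch n with
  | O => left; reflexivity
  | S ?m => right; in_list m
  end.

Ltac range_iff :=
  let y := fresh "y" in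
  intro y; simpl; split;
  [ first [by move: y => [[]|] // _; first [by exists tt|by exists true|by exists false]
          |by move: y => [] // _; first [by exists tt|by exists true|by exists false]]
  | by case=> -[] _ <- ].

Ltac absurd_at y Hr :=
  let h1 := fresh in let h2 := fresh in
  case: (Hr y) => h1 h2;
  first [ by move: (h1 ltac:(assumption)) => -[] []
        | by match goal with H : ~ _ |- _ =>
            apply: H; apply: h2; first [by exists tt|by exists true|by exists false]
          end ].

Ltac pick_face setE n :=
  eexists; split;
  [ split; [in_list n | apply/setE; range_iff]
  | let p := fresh "p" in let H := fresh "H" in let Hr := fresh "Hr" in
    move=> p [H /setE Hr]; repeat destruct H as [<-|H]; try reflexivity;
    try (by case: H); simpl in Hr; exfalso;
    first [absurd_at true Hr|absurd_at false Hr
          |absurd_at (Some true) Hr|absurd_at (Some false) Hr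
          |absurd_at (@None bool) Hr] ].

Lemma hat_generalised_simplicial_complex (X : vh_complex) :
  generalised_simplicial_complex (hat_complex X).
Proof.
have notT (T : Type) (A : set T) (x : T) : ~ A x -> A != setT.
  by move=> Ax; apply/eqP => AT; apply: Ax; rewrite AT.
split.
{ by case=> *; first [exists tt|exists true|exists None]. }
{ case=> [v|e|q|h|e b|q v|o|o|o c] p //=; intros H;
    repeat destruct H as [<-|H] => //=.
  all: split; first by move=> [] [] //=; case: (side_flip _).
  all: first [ apply: (notT _ _ false) => -[? _]; done
             | apply: (notT _ _ true) => -[? _]; done
             | apply: (notT _ _ None) => -[? _]; done
             | apply: (notT _ _ (Some true)) => -[[] _]; done
             | apply: (notT _ _ (Some false)) => -[[] _]; done ]. }
{ case=> [v|e|q|h|e b|q v|o|o|o c] p p' //=; intros H;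
    repeat destruct H as [<-|H] => //=; intros H;
    repeat destruct H as [<-|H] => //=.
  all: rewrite /hat_face /= /side_end ?corner_side.
  all: try (by tauto).
  all: rewrite /side_flip /side_square /comp; case: (flip _ _ _) => /=; tauto. }
{ have setE (T U : Type) (f : T -> U) (B : set U) :
    (range f = B) <-> (forall y, B y <-> range f y).
    by split=> [<- //|H]; apply/seteqP; split=> y /H.
  have neT (T : Type) (B : set T) : B != setT -> ~ (forall x, B x).
    by move=> /eqP BT Bx; apply: BT; apply/seteqP; split.
  case=> [v|e|q|h|e b|q v|o|o|o c] A /= [x Ax] /neT AT.
  all: try (by exfalso; apply: AT; case; case: x Ax).
  1-4: have [Af|Af] := pselect (A false); have [At|At] := pselect (A true).
  17-18: have [An|An] := pselect (A None);
     have [Af|Af] := pselect (A (Some false));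
     have [At|At] := pselect (A (Some true)).
  all: try (by exfalso; apply: AT; case=> [[]|] //).
  all: try (by exfalso; apply: AT; case).
  all: try (by exfalso; case: x Ax => [[]|]).
  all: try (by exfalso; case: x Ax).
  all: try case: (side_flip _).
  all: by first [pick_face setE 0%nat|pick_face setE 1%nat|pick_face setE 2%nat
                |pick_face setE 3%nat|pick_face setE 4%nat|pick_face setE 5%nat]. }
Qed.

(* The squares adjacent to e, counted with multiplicity.  [fset_set] is only
   meaningful on finite sets. *)
Definition adjacent_sides (X : vh_complex) (e : vedge X) : {fset vside X} :=
  fset_set [set o : vside X | vside_edge o = e].

(* X^* is presented by the simplices of X^ and the simplices to be attached to
   them; no further identifications are made than those generated by the listed
   maps.  The other faces of the attached simplices are not listed separately,
   which does not affect the realisation. *)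
Inductive star_simplex (X : vh_complex) :=
| StarHat of hat_simplex X
| StarSigma of vedge X & bool   (* v_b^* e^* s_1^* ... s_n^* *)
| StarCommon of vedge X.        (* e^* s_1^* ... s_n^* *)

HB.instance Definition _ (X : vh_complex) := gen_eqMixin (star_simplex X).
HB.instance Definition _ (X : vh_complex) := gen_choiceMixin (star_simplex X).

(* In [StarCommon e], [None] is e^* and [Some o] is s^* for the side o of s;
   [StarSigma e b] has one more vertex [None], which is v_b^*. *)
Definition star_vtx (X : vh_complex) (s : star_simplex X) : finType :=
  match s with
  | StarHat s => hat_vtx s
  | StarSigma e _ => option (option (adjacent_sides e))
  | StarCommon e => option (adjacent_sides e)
  end.

Definition half_in_sigma (A : Type) : bool -> option (option A) :=
  fun k => if k then Some None else None.

Definition triangle_in_sigma (A : Type) (o : A) :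
    option bool -> option (option A) :=
  fun k => if k is Some k then half_in_sigma A k else Some (Some o).

Definition star_face (X : vh_complex) (K : finType) (t : star_simplex X)
    (f : star_vtx t -> K) : {t : star_simplex X & star_vtx t -> K} :=
  existT _ t f.

(* The half edge v_b^* e^* is glued explicitly; this is implied by the gluing of
   the triangles as soon as e is adjacent to some square. *)
Definition star_face_maps (X : vh_complex) (s : star_simplex X) :
    set {t : star_simplex X & star_vtx t -> star_vtx s} :=
  match s with
  | StarHat s =>
      [set star_face (t := StarHat (projT1 p)) (projT2 p) |
        p in [set p | List.In p (hat_faces s)]]
  | StarSigma e b =>
      [set star_face (t := StarCommon e) Some] `|`
      [set star_face (t := StarHat (HatHalf e b)) (half_in_sigma _)] `|`
      [set star_face
             (t := StarHat (HatVTriangle (val o) (b (+) side_flip (val (val o)))))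
             (triangle_in_sigma o) | o in [set: adjacent_sides e]]
  | StarCommon _ => set0
  end.

Definition simplexification (X : vh_complex) : simplicial_gluing :=
  SimplicialGluing (@star_face_maps X).

(* Main.v *)
Require Import Defs.
From mathcomp Require Import all_boot all_order all_algebra finmap.
From mathcomp Require Import generic_quotient ring lra.
From mathcomp Require Import all_classical all_reals all_analysis.
From Stdlib Require Import Relation_Operators.
From Stdlib Require List.
Import Order.TTheory GRing.Theory Num.Theory.
Import numFieldNormedType.Exports.

(* The triangulation X^ is a subdivision of X, so that the affine maps from its
   simplices to the cells of X and the piecewise affine maps from the cells of X
   to X^ are inverse to each other.  Each attached simplex v e s_1 ... s_n
   retracts onto the union of its triangles v e s_i, compatibly with the
   gluings, so that the map X^ -> X extends to X^*.  The composite X -> X^* -> X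
   is then the identity, and X^* -> X -> X^* is homotopic to the identity along
   straight lines in the attached simplices. *)

Set Implicit Arguments.
Unset Strict Implicit.
Unset Printing Implicit Defensive.

Local Open Scope classical_set_scope.
Local Open Scope ring_scope.

(** * Continuity and realisations *)

(** The triangulation X^ is never realised as a space of its own. A map from X^ to a space U is a
    family [Phi] of maps on its simplices that respects faces. Every such family yields both a map X
    -> U, by subdividing the cells, and a map X^* -> U, by retracting the attached simplices. The
    families with values in X and in X^* give the two maps of the equivalence, and the composites
    are computed by naturality in U.

    The retraction of a simplex v e s_1 ... s_n must be continuous, fix each triangle v e s_i
    pointwise and preserve the face opposite to v, acting there independently of v; otherwise it
    would not respect the gluings. So it keeps the weight at v and moves weight from the s_i to e^*
    until at most one s_i carries any. The same properties make the straight-line homotopy constant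
    on the triangles and well defined on the common face of the two simplices attached at e. All
    this takes place in the affine simplices before gluing, with one coordinate for each occurrence
    of a square, so that identified vertices cause no difficulty. *)

Lemma ptws_continuous (T U : topologicalType) (K : Type)
    (F : T -> {ptws K -> U}) :
  (forall k, continuous (fun x => F x k)) -> continuous F.
Proof.
move=> cF x; apply/cvg_sup => k.
move: x; apply/(@continuousP _ (initial_topology (@^~ k))) => A [B oB <-].
by have /continuousP := cF k; apply.
Qed.

Lemma ptws_eval_continuous (U : topologicalType) (K : eqType) (k : K) :
  continuous (fun x : {ptws K -> U} => x k).
Proof. exact: (@proj_continuous K (fun=> U) k). Qed.

Lemma set_type_continuous (T U : topologicalType) (A : set U) (F : T -> A) :
  continuous (fun x => set_val (F x)) -> continuous F.
Proof. exact: continuous_comp_initial. Qed.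

Lemma set_type_eval_continuous (U : topologicalType) (K : eqType)
    (A : set {ptws K -> U}) (k : K) : continuous (fun x : A => set_val x k).
Proof.
move=> x; apply: (@continuous_comp _ _ _ (set_val : A -> _) (fun y => y k)).
  exact: initial_continuous.
exact: ptws_eval_continuous.
Qed.

Lemma continuous_set_type_eval (T U : topologicalType) (K : eqType)
    (A : set {ptws K -> U}) (F : T -> A) (k : K) :
  continuous F -> continuous (fun x => set_val (F x) k).
Proof.
move=> cF x; apply: (@continuous_comp _ _ _ F (fun y : A => set_val y k)).
  exact: cF.
exact: set_type_eval_continuous.
Qed.

Lemma continuous_pair (S T U : topologicalType) (f : S -> T) (g : S -> U) :
  continuous f -> continuous g -> continuous (fun x => (f x, g x)).
Proof.
move=> cf cg x.
exact: (@cvg_pair _ _ _ (nbhs x) (nbhs (f x)) (nbhs (g x)) _ _ _ f g (cf x) (cg x)).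
Qed.

Lemma paste_continuous (T U : topologicalType) (I : finType) (A : I -> set T)
    (h : I -> T -> U) (F : T -> U) :
  (forall i, closed (A i)) -> (forall i, continuous (h i)) ->
  (forall x, exists i, A i x) -> (forall i x, A i x -> F x = h i x) ->
  continuous F.
Proof.
move=> cA ch covA Fh; apply/continuous_closedP => C cC.
rewrite (_ : F @^-1` C = \bigcup_(i in [set: I]) (A i `&` h i @^-1` C)).
  apply: closed_bigcup => [|i _]; first exact: finite_finset.
  by apply: closedI => //; have /continuous_closedP := ch i; apply.
apply/seteqP; split=> [x Cx|x [i _ [Aix]] /=]; last by rewrite (Fh i).
by have [i Aix] := covA x; exists i => //; split=> //=; rewrite -(Fh i).
Qed.

Section RealFunctions.
Variables (R : realType) (T : topologicalType).
Implicit Types f g : T -> R.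

Lemma continuous_cstr (a : R) : continuous (fun _ : T => a).
Proof. by move=> x; exact: cvg_cst. Qed.

Lemma continuous_addr f g :
  continuous f -> continuous g -> continuous (fun x => f x + g x).
Proof. by move=> cf cg x; apply: cvgD; [exact: cf|exact: cg]. Qed.

Lemma continuous_oppr f : continuous f -> continuous (fun x => - f x).
Proof. by move=> cf x; apply: cvgN; exact: cf. Qed.

Lemma continuous_mulr f g :
  continuous f -> continuous g -> continuous (fun x => f x * g x).
Proof. by move=> cf cg x; apply: cvgM; [exact: cf|exact: cg]. Qed.

Lemma continuous_normr f : continuous f -> continuous (fun x => `|f x|).
Proof. by move=> cf x; apply: cvg_norm; exact: cf. Qed.

Lemma continuous_minr f g :
  continuous f -> continuous g -> continuous (fun x => Num.min (f x) (g x)).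
Proof. by move=> cf cg x; apply: continuous_min; [exact: cf|exact: cg]. Qed.

Lemma continuous_maxr f g :
  continuous f -> continuous g -> continuous (fun x => Num.max (f x) (g x)).
Proof. by move=> cf cg x; apply: continuous_max; [exact: cf|exact: cg]. Qed.

Lemma continuous_sumr (I : finType) (F : I -> T -> R) :
  (forall i, continuous (F i)) -> continuous (fun x => \sum_i F i x).
Proof.
move=> cF; apply: continuous_big => //.
exact: (@pseudometric_normed_Zmodule.add_continuous _ R^o).
Qed.

End RealFunctions.

Ltac rcont :=
  repeat first
    [ assumption
    | lazymatch goal with
      | |- continuous (fun _ => ?c) => exact: continuous_cstr
      | |- continuous (fun x => set_val _ _) => exact: set_type_eval_continuous
      | |- continuous (fun x => Num.max _ _) => apply: continuous_maxr
      | |- continuous (fun x => Num.min _ _) => apply: continuous_minr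
      | |- continuous (fun x => `|_|) => apply: continuous_normr
      | |- continuous (fun x => _ + _) => apply: continuous_addr
      | |- continuous (fun x => - _) => apply: continuous_oppr
      | |- continuous (fun x => _ * _) => apply: continuous_mulr
      | |- continuous (fun x => \sum_i _) => apply: continuous_sumr => ?
      end ].

Definition in_body (T : Type) (A : set T) (x : T) (h : A x) : A :=
  exist _ x (mem_set h).

Lemma in_body_eq (T : Type) (A : set T) (x y : T) (h : A x) (h' : A y) :
  x = y -> in_body h = in_body h'.
Proof. by move=> xy; apply: eq_sig_hprop. Qed.

Lemma in_body_continuous (T U : topologicalType) (K : Type)
    (A : set {ptws K -> U}) (F : T -> {ptws K -> U}) (h : forall x, A (F x)) :
  (forall k, continuous (fun x => F x k)) ->
  continuous (fun x => in_body (h x) : A).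
Proof. by move=> cF; apply: set_type_continuous; exact: ptws_continuous. Qed.

(** * Points of a realisation, and maps and homotopies out of it *)

Section Realisation.
Variables (R : realType) (G : gluing R).

Definition cls (c : cell G) (x : body G c) : realisation G :=
  (\pi_(realisation G) (existT _ c x : cell_point G))%qT.

Lemma cls_continuous c : continuous (@cls c).
Proof.
move=> x; apply: (@continuous_comp _ _ _ (existT (fun c => body G c : Type) c)).
  exact: existT_continuous.
exact: pi_continuous.
Qed.

Lemma cls_ind (P : realisation G -> Prop) :
  (forall c (x : body G c), P (cls x)) -> forall x, P x.
Proof.
by move=> Pc x; rewrite -[x]reprK; case: (repr x : cell_point G) => c y; apply: Pc.
Qed.

Lemma cls_glue c c' (m : {ptws Defs.coord c' -> R} -> {ptws Defs.coord c -> R})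
    (x : body G c) (y : body G c') :
  attach G c (existT _ c' m) -> m (set_val y) = set_val x -> cls y = cls x.
Proof.
move=> am mx; rewrite /cls; apply/eqmodP/asboolP; apply: rst_step.
by exists m.
Qed.

Section Lift.
Variables (U : Type) (F : forall c, body G c -> U).
Hypothesis FG : forall c c' m (x : body G c) (y : body G c'),
  attach G c (existT _ c' m) -> m (set_val y) = set_val x -> F y = F x.

Definition glue_lift (x : realisation G) : U :=
  let p : cell_point G := repr x in F (projT2 p).

Lemma glue_lift_cls c (x : body G c) : glue_lift (cls x) = F x.
Proof.
rewrite /glue_lift; set p := repr _.
have : glue_rel p (existT _ c x : cell_point G).
  by apply/(@eqmodP _ (glue_equiv G)); rewrite /p /cls reprK.
move=> /asboolP; suff FE a b : clos_refl_sym_trans _ (@glued R G) a b ->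
    F (projT2 a) = F (projT2 b) by move=> /FE.
elim=> // [[c1 x1] [c2 x2] [f /= af fx]|{}a {}b d _ -> _ ->] //.
exact: FG af fx.
Qed.
End Lift.

Lemma realisation_continuous (U : topologicalType) (F : realisation G -> U) :
  (forall c, continuous (fun x : body G c => F (cls x))) -> continuous F.
Proof.
move=> cF; apply/quotient_continuous => -[c x] B nB.
exact: (cF c x B nB).
Qed.

(* R is locally compact, so taking products with R preserves quotient maps;
   here this is read off the exponential law for the compact-open topology. *)
Lemma realisation_homotopy_continuous (U : topologicalType)
    (H : realisation G * R -> U) :
  (forall c, continuous (fun p : body G c * R => H (cls p.1, p.2))) ->
  continuous H.
Proof.
move=> cH; rewrite (_ : H = uncurry (curry H)); last by apply/funext=> -[].
have cHc c := continuous_curry (cH c).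
apply: continuous_uncurry; [exact: locally_compactR|exact: Rhausdorff| |].
  apply: (@realisation_continuous {compact-open, R -> U}) => c.
  have [h _] := cHc c; exact: h.
apply: cls_ind => c x; have [_ h] := cHc c; exact: h.
Qed.

End Realisation.

(** * Maps on the triangulation *)

Lemma big_option_sum (V : nmodType) (K : finType) (F : option K -> V) :
  \sum_k F k = F None + \sum_k F (Some k).
Proof.
rewrite (bigD1 None) //=; congr (_ + _).
rewrite (reindex_omap Some id) => [|[]] //=.
by apply: eq_bigl => k; rewrite eqxx.
Qed.

Lemma big_unit_sum (V : nmodType) (F : unit -> V) : \sum_k F k = F tt.
Proof. by rewrite (bigD1 tt) //= big1 ?addr0 // => -[]. Qed.

Section Simplices.
Variable R : realType.

Definition splx (K : finType) : set {ptws K -> R} := @std_simplex R K.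
Arguments splx : clear implicits.

Lemma splx_eq (K : finType) (w w' : splx K) :
  (forall k, set_val w k = set_val w' k) -> w = w'.
Proof.
by move=> ww'; apply: val_inj; apply/funext => k; have := ww' k; rewrite !set_valE.
Qed.

Lemma splx_ge0 (K : finType) (w : splx K) k : 0 <= set_val w k.
Proof. by have [h _] := set_valP w; exact: h. Qed.

Lemma splx_sum (K : finType) (w : splx K) : \sum_k set_val w k = 1.
Proof. by have [_ h] := set_valP w; exact: h. Qed.

Lemma simplex_map_splx (K L : finType) (f : K -> L) (w : splx K) :
  splx L (simplex_map f (set_val w)).
Proof.
split=> [l|]; first by apply: sumr_ge0 => k _; exact: splx_ge0.
rewrite -(splx_sum w) /simplex_map.
by rewrite [RHS](partition_big f predT) //=.
Qed.

Definition push (K L : finType) (f : K -> L) (w : splx K) : splx L :=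
  in_body (simplex_map_splx f w).

Lemma push_inj (K L : finType) (f : K -> L) (w : splx K) k :
  injective f -> set_val (push f w) (f k) = set_val w k.
Proof.
move=> fI; rewrite set_valE /= /simplex_map (bigD1 k) //= big1 ?addr0 //.
by move=> j /andP[/eqP/fI ->]; rewrite eqxx.
Qed.

Lemma push_out (K L : finType) (f : K -> L) (w : splx K) l :
  (forall k, f k <> l) -> set_val (push f w) l = 0.
Proof.
by move=> fl; rewrite set_valE /= /simplex_map big1 // => k /eqP /fl.
Qed.

(** The fibres of [f] have at most one element, so restricting the coordinates of [z] along [f]
    gives a preimage. This is how a point of a simplex is recognised as a point of one of its
    faces. *)
Lemma splx_supported (K L : finType) (f : K -> L) (z : splx L) :
  injective f -> (forall l, (forall k, f k <> l) -> set_val z l = 0) ->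
  exists2 w : splx K, z = push f w & forall k, set_val w k = set_val z (f k).
Proof.
move=> fI z0.
have zE l : \sum_(k | f k == l) set_val z (f k) = set_val z l.
  have [/existsP[k /eqP <-]|/existsPn lf] := boolP [exists k, f k == l].
    rewrite (bigD1 k) //= big1 ?addr0 // => j /andP[/eqP/fI ->].
    by rewrite eqxx.
  rewrite big1 => [|k fk]; first by rewrite z0 // => k; apply/eqP.
  by have := lf k; rewrite fk.
have h : splx K (fun k => set_val z (f k)).
  split=> [k|]; first exact: splx_ge0.
  by rewrite (partition_big f predT) //= -[RHS](splx_sum z); apply: eq_bigr.
exists (in_body h) => [|k]; last by rewrite set_valE.
by apply: splx_eq => l; rewrite -zE.
Qed.

Lemma splx_unit (w : splx unit) : set_val w tt = 1.
Proof. by rewrite -(splx_sum w) big_unit_sum. Qed.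

Lemma splx_bool (w : splx bool) : set_val w false = 1 - set_val w true.
Proof. by rewrite -(splx_sum w) big_bool /=; ring. Qed.

Lemma splx_option_bool (w : splx (option bool)) :
  set_val w (Some true) = 1 - set_val w None - set_val w (Some false).
Proof. by rewrite -(splx_sum w) big_option_sum big_bool /=; ring. Qed.

End Simplices.
Arguments splx : clear implicits.

(** * Face-compatible families of maps on the simplices of X^ *)

Section HatFamily.
Variables (R : realType) (X : vh_complex) (U : Type).
Variable Phi : forall t : hat_simplex X, splx R (hat_vtx t) -> U.
Arguments Phi : clear implicits.

(** Such a family stands for a map from the realisation of X^ to [U]. It is used with values in X
    and in X^*. *)
Definition face_compatible := forall s p w, List.In p (hat_faces s) ->
  Phi (projT1 p) w = Phi s (push (projT2 p) w).

Hypothesis PhiP : face_compatible.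

Lemma Phi_face s t (f : hat_vtx t -> hat_vtx s) (z : splx R (hat_vtx s)) :
  List.In (hat_face f) (hat_faces s) -> injective f ->
  (forall l, (forall k, f k <> l) -> set_val z l = 0) ->
  exists2 w, Phi s z = Phi t w & forall k, set_val w k = set_val z (f k).
Proof.
move=> fs fI z0; have [w -> wE] := splx_supported fI z0.
by exists w; [rewrite -(@PhiP s (hat_face f) w fs)|move=> k; rewrite push_inj].
Qed.

(** Both points come from the same point of the shared face [t]. [Phi_half_mid], [Phi_vtri_mid] and
    [Phi_corner] are the instances at a midpoint, a midpoint spoke and a corner spoke. *)
Lemma Phi_common_face t s s' (f : hat_vtx t -> hat_vtx s)
    (f' : hat_vtx t -> hat_vtx s') (z : splx R (hat_vtx s))
    (z' : splx R (hat_vtx s')) :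
  List.In (hat_face f) (hat_faces s) -> injective f ->
  List.In (hat_face f') (hat_faces s') -> injective f' ->
  (forall l, (forall k, f k <> l) -> set_val z l = 0) ->
  (forall l, (forall k, f' k <> l) -> set_val z' l = 0) ->
  (forall k, set_val z (f k) = set_val z' (f' k)) ->
  Phi s z = Phi s' z'.
Proof.
move=> fs fI fs' fI' z0 z0' zz'.
have [w -> wE] := Phi_face fs fI z0; have [w' -> wE'] := Phi_face fs' fI' z0'.
by congr Phi; apply: splx_eq => k; rewrite wE wE'.
Qed.

Lemma Phi_half_mid e b b' (z : splx R bool) : set_val z false = 0 ->
  Phi (HatHalf e b) z = Phi (HatHalf e b') z.
Proof.
move=> z0; apply: (@Phi_common_face (HatMid e) (HatHalf e b) (HatHalf e b')
  (fun=> true) (fun=> true)) => //=; try by [right; left|case=> -[]].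
all: by case=> // /(_ tt).
Qed.

Lemma Phi_vtri_mid o c c' (z : splx R (option bool)) :
  set_val z (Some false) = 0 ->
  Phi (HatVTriangle o c) z = Phi (HatVTriangle o c') z.
Proof.
move=> z0; apply: (@Phi_common_face (HatMidSpoke o) (HatVTriangle o c)
  (HatVTriangle o c') (spoke_map true) (spoke_map true)) => //=;
  try by [do 5 right; left|case=> -[]].
all: by case=> [[]|] // => [/(_ false)|/(_ true)].
Qed.

Lemma Phi_vtri_half o c (z : splx R (option bool)) (z' : splx R bool) :
  set_val z None = 0 -> set_val z (Some false) = set_val z' false ->
  Phi (HatVTriangle o c) z =
  Phi (HatHalf (vside_edge o) (c (+) side_flip (val o))) z'.
Proof.
move=> z0 zz'.
have [w -> wE] := @Phi_face (HatVTriangle o c)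
  (HatHalf (vside_edge o) (c (+) side_flip (val o))) Some z
  ltac:(do 3 right; left; reflexivity) ltac:(by move=> ? ? []) 
  ltac:(by case=> [b /(_ b)|]).
congr Phi; apply: splx_eq => -[]; last by rewrite wE.
have := splx_bool w; have := splx_bool z'; have := wE false; lra.
Qed.

Lemma Phi_htri_edge o (z : splx R (option bool)) (z' : splx R bool) :
  set_val z None = 0 ->
  set_val z (Some (side_flip (val o))) = set_val z' false ->
  Phi (HatHTriangle o) z = Phi (HatHEdge (hside_edge o)) z'.
Proof.
move=> z0 zz'.
have [w -> wE] := @Phi_face (HatHTriangle o) (HatHEdge (hside_edge o))
  (fun c => Some (c (+) side_flip (val o))) z
  ltac:(do 3 right; left; reflexivity)
  ltac:(by move=> ? ? [] /addIb) 
  ltac:(by case=> [b /(_ (b (+) side_flip (val o)))|//]; rewrite /= addbK).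
have := wE false; rewrite addFb zz' => wz.
congr Phi; apply: splx_eq => -[]; last by [].
have := splx_bool w; have := splx_bool z'; lra.
Qed.

(** The two triangles meet along the spoke from their common corner to the centre. It is opposite to
    the midpoint in the first and to the other corner in the second, which explains the two
    vanishing coordinates. *)
Lemma Phi_corner ov oh c c' (z z' : splx R (option bool)) :
  side_square (val ov) = side_square (val oh) ->
  side_end (val ov) c = side_end (val oh) c' ->
  set_val z (Some true) = 0 -> set_val z' (Some (~~ c')) = 0 ->
  set_val z None = set_val z' None ->
  Phi (HatVTriangle ov c) z = Phi (HatHTriangle oh) z'.
Proof.
move=> sE eE z0 z0' zz'; apply: (@Phi_common_face (HatCornerSpoke
  (side_square (val ov)) (side_end (val ov) c)) (HatVTriangle ov c)
  (HatHTriangle oh) (spoke_map false) (spoke_map c')) => //=.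
- by do 4 right; left.
- by case=> -[].
- by rewrite sE eE; case: c' {eE z0'}; [do 5 right; left|do 4 right; left].
- by case=> -[].
- by case=> [[]|] // => [/(_ false)|/(_ true)].
- case=> [b|/(_ true) //] bE; rewrite (_ : b = ~~ c') //.
  case: (b =P c') => [bc|]; first by case: (bE false); rewrite /= bc.
  by case: b c' {eE z0' bE} => -[].
- case=> //=; have := splx_option_bool z; have := splx_sum z'.
  rewrite big_option_sum big_bool /=.
  case: c' z0' {eE} => /= ?; lra.
Qed.

Lemma Phi_vtri_centre o c (z : splx R (option bool)) (z' : splx R unit) :
  set_val z None = 1 ->
  Phi (HatVTriangle o c) z = Phi (HatCentre (side_square (val o))) z'.
Proof.
move=> z1; have z0 k : set_val z (Some k) = 0.
  have := splx_option_bool z; have := splx_ge0 z (Some true).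
  have := splx_ge0 z (Some false); case: k; lra.
have [w -> wE] := @Phi_face (HatVTriangle o c)
  (HatCentre (side_square (val o))) (fun=> None) z
  ltac:(do 2 right; left; reflexivity) ltac:(by case=> -[])
  ltac:(by case=> // /(_ tt)).
by congr Phi; apply: splx_eq => -[]; rewrite !splx_unit.
Qed.

Lemma Phi_htri_centre o (z : splx R (option bool)) (z' : splx R unit) :
  set_val z None = 1 ->
  Phi (HatHTriangle o) z = Phi (HatCentre (side_square (val o))) z'.
Proof.
move=> z1; have z0 k : set_val z (Some k) = 0.
  have := splx_option_bool z; have := splx_ge0 z (Some true).
  have := splx_ge0 z (Some false); case: k; lra.
have [w -> wE] := @Phi_face (HatHTriangle o)
  (HatCentre (side_square (val o))) (fun=> None) z
  ltac:(do 2 right; left; reflexivity) ltac:(by case=> -[])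
  ltac:(by case=> // /(_ tt)).
by congr Phi; apply: splx_eq => -[]; rewrite !splx_unit.
Qed.

End HatFamily.

(** * The map from the triangulation to X *)

Section Collapse.
Variables (R : realType) (X : vh_complex).

Local Notation SX := (realisation (sq_gluing R X)).

Definition sqcls (c : sq_cell X) (x : @cube R (sq_coord c)) : SX :=
  @cls R (sq_gluing R X) c x.

Definition barycentre (K C : finType) (w : K -> R) (p : K -> C -> R) :
    {ptws C -> R} :=
  fun c => \sum_k w k * p k c.

Lemma barycentre_cube (K C : finType) (w : splx R K) (p : K -> C -> R) :
  (forall k, @cube R C (p k)) -> @cube R C (barycentre (set_val w) p).
Proof.
move=> p01 c; apply/andP; split.
  apply: sumr_ge0 => k _; apply: mulr_ge0; first exact: splx_ge0.
  by case/andP: (p01 k c).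
rewrite -(splx_sum w); apply: ler_sum => k _; rewrite ler_piMr ?splx_ge0 //.
by case/andP: (p01 k c).
Qed.

Lemma barycentre_push (K L C : finType) (f : K -> L) (w : splx R K)
    (p : L -> C -> R) :
  barycentre (set_val (push f w)) p = barycentre (set_val w) (p \o f).
Proof.
apply/funext => c; rewrite /barycentre [RHS](partition_big f predT) //=.
apply: eq_bigr => l _.
rewrite (_ : set_val _ l = \sum_(k | f k == l) set_val w k) // mulr_suml.
by apply: eq_bigr => k /eqP ->.
Qed.

Definition affine (C D : finType) (m : {ptws C -> R} -> {ptws D -> R}) :=
  forall (K : finType) (w : splx R K) (p : K -> C -> R),
    m (barycentre (set_val w) p) = barycentre (set_val w) (fun k => m (p k)).

Lemma splx_sum_cst (K : finType) (w : splx R K) (a : R) :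
  \sum_k set_val w k * a = a.
Proof. by rewrite -mulr_suml splx_sum mul1r. Qed.

Lemma affine_end_map b : affine (@end_map R b).
Proof. by move=> K w p; apply/funext => c; rewrite /barycentre splx_sum_cst. Qed.

Lemma affine_corner_map v : affine (@corner_map R v).
Proof. by move=> K w p; apply/funext => c; rewrite /barycentre splx_sum_cst. Qed.

Lemma affine_side_map d b fl : affine (@side_map R d b fl).
Proof.
move=> K w p; apply/funext => c; rewrite /barycentre /side_map.
case: (c == d); first by rewrite splx_sum_cst.
case: fl => //; rewrite -[X in X - _](splx_sum w) -sumrB.
by apply: eq_bigr => k _; rewrite mulrBr mulr1.
Qed.

Lemma sq_attach_affine (c : sq_cell X) p :
  @sq_attach R X c p -> affine (projT2 p).
Proof.
case: c p => [v|e|s] p //=.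
- by case=> b ->; exact: affine_end_map.
- case=> [[d [b ->]]|[v ->]]; first exact: affine_side_map.
  exact: affine_corner_map.
Qed.

(** The cell of X whose interior contains the interior of the simplex. *)
Definition carrier (t : hat_simplex X) : sq_cell X :=
  match t with
  | HatVertex v => VertexCell v
  | HatMid e => EdgeCell (val e)
  | HatCentre s => SquareCell s
  | HatHEdge h => EdgeCell (val h)
  | HatHalf e _ => EdgeCell (val e)
  | HatCornerSpoke s _ => SquareCell s
  | HatMidSpoke o => SquareCell (side_square (val o))
  | HatHTriangle o => SquareCell (side_square (val o))
  | HatVTriangle o _ => SquareCell (side_square (val o))
  end.

Definition corner_pos (p : bool * bool) (k : bool) : R :=
  if k then p.2%:R else p.1%:R.

Definition mid_pos (o : square X * bool * bool) (k : bool) : R :=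
  if k == o.1.2 then o.2%:R else 2^-1.

(** A vertex cell has no coordinates, so the value 0 for [HatVertex] is a dummy. *)
Definition pos (t : hat_simplex X) : hat_vtx t -> sq_coord (carrier t) -> R :=
  match t with
  | HatVertex v => fun _ _ => 0
  | HatMid e => fun _ _ => 2^-1
  | HatCentre s => fun _ _ => 2^-1
  | HatHEdge h => fun k _ => k%:R
  | HatHalf e b => fun k _ => if k then 2^-1 else b%:R
  | HatCornerSpoke s p => fun k => if k then fun _ => 2^-1 else corner_pos p
  | HatMidSpoke o => fun k => if k then fun _ => 2^-1 else mid_pos (val o)
  | HatHTriangle o =>
      fun k => if k is Some c then corner_pos (side_end (val o) c) else fun _ => 2^-1
  | HatVTriangle o c =>
      fun k => match k with
               | None => fun _ => 2^-1
               | Some true => mid_pos (val o)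
               | Some false => corner_pos (side_end (val o) c)
               end
  end.

Lemma pos_cube t k : @cube R _ (@pos t k).
Proof.
have h (b : bool) : (0 <= b%:R :> R) && (b%:R <= 1 :> R).
  by case: b; rewrite /= ?lexx ?ler01.
have h2 : (0 <= 2^-1 :> R) && (2^-1 <= 1 :> R) by lra.
have hc p : @cube R _ (corner_pos p) by case=> /=.
have hm o : @cube R _ (mid_pos o) by move=> i; rewrite /mid_pos; case: ifP.
case: t k => [v|e|q|e|e b|q v|o|o|o c] k.
- by case.
- by move=> ?.
- by move=> ?.
- by move=> ?; exact: h.
- by move=> ?; rewrite /pos; case: k.
- by rewrite /pos; case: k => // ?.
- by rewrite /pos; case: k => // ?.
- by rewrite /pos; case: k => [?|] // ?.
- by rewrite /pos; case: k => [[]|] // ?.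
Qed.

Definition hat_to_sq (t : hat_simplex X) (w : splx R (hat_vtx t)) : SX :=
  sqcls (in_body (barycentre_cube w (@pos_cube t))).

(** Attaching maps of X commute with barycentres, so compatibility with them is a finite check on
    the vertices of a simplex. *)
Lemma barycentre_glue (K : finType) (w : splx R K) (c c' : sq_cell X)
    (p : K -> sq_coord c -> R) (p' : K -> sq_coord c' -> R)
    (h : @cube R _ (barycentre (set_val w) p))
    (h' : @cube R _ (barycentre (set_val w) p')) m :
  @sq_attach R X c (existT _ c' m) -> (forall k, m (p' k) = p k) ->
  sqcls (in_body h') = sqcls (in_body h).
Proof.
move=> am mp; apply: (cls_glue (G := sq_gluing R X) am).
have /= -> := sq_attach_affine am w p'.
by congr (barycentre _ _); apply/funext.
Qed.

Lemma hat_to_sq_face : face_compatible hat_to_sq.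
Proof.
move=> s p w; rewrite /hat_to_sq => ps.
(* The same point, written in the carrier of [s] instead of that of the face. Passing from one to
   the other is a gluing in X, or nothing when the carriers coincide. *)
pose h := barycentre_cube w (fun k => @pos_cube s (projT2 p k)).
transitivity (sqcls (in_body h)); last first.
  by congr sqcls; apply: in_body_eq; rewrite barycentre_push.
(* Reversing an edge fixes its midpoint. *)
have half : 1 - 2^-1 = 2^-1 :> R by lra.
case: s p w ps h => [v|e|q|e|e b|q v|o|o|o c] p w //= ps.
all: repeat destruct ps as [<-|ps] => //=.
all: try by move=> h; congr sqcls; apply: in_body_eq;
  congr (barycentre _ _); apply/funext => -[].
all: move=> h; apply: barycentre_glue => /=.
all: try by [eexists; reflexivity|right; eexists; reflexivity
            |left; do 2 eexists; reflexivity].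
all: move: half; clear; move=> half k; apply/funext => j.
all: case: o => -[[q d] b] ho; rewrite /side_map /corner_pos /mid_pos /side_flip
  /side_end /side_square /side_corner /=.
all: case: (flip q d b); case: d {ho}; case: j; try case: k; try case: c;
  by rewrite /= ?subrr ?subr0 ?half.
Qed.

Lemma hat_to_sq_continuous t : continuous (@hat_to_sq t).
Proof.
move=> x; apply: continuous_comp; last exact: cls_continuous.
move: x; apply: in_body_continuous => c.
apply: continuous_sumr => k; apply: continuous_mulr; rcont.
Qed.
End Collapse.

(** * Extension to the attached simplices *)

Section Excess.
Variables (R : realType) (A : finType).
Implicit Types w : splx R (option (option A)).

Local Notation pt o := (Some (Some o)).

(* At most one of the numbers w_o - sum_(j <> o) w_j is positive, so that
   replacing the w_o by these positive parts retracts a simplex v e s_1 ... s_n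
   onto the union of its triangles v e s_i. *)
Definition excess w (o : A) : R :=
  Num.max 0 (2 * set_val w (pt o) - \sum_j set_val w (pt j)).

Lemma excess_ge0 w o : 0 <= excess w o.
Proof. by rewrite /excess le_max lexx. Qed.

Lemma excess_le w o : excess w o <= set_val w (pt o).
Proof.
rewrite /excess ge_max splx_ge0 /= (bigD1 o) //=.
have : 0 <= \sum_(j | j != o) set_val w (pt j).
  by apply: sumr_ge0 => j _; exact: splx_ge0.
by lra.
Qed.

(** For distinct o and a, the two differences defining the excesses add up to -2 times the sum of
    the other weights, so they cannot both be positive. *)
Lemma excess_uniq w o a : 0 < excess w o -> 0 < excess w a -> o = a.
Proof.
rewrite /excess !lt_max ltxx /= => h h'; apply/eqP/negPn/negP => oa.
move: h h'; rewrite (bigD1 o) //= (bigD1 a) 1?eq_sym //=.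
have : 0 <= \sum_(j | (j != o) && (j != a)) set_val w (pt j).
  by apply: sumr_ge0 => j _; exact: splx_ge0.
by lra.
Qed.

Lemma excess0 w o : set_val w (pt o) = 0 -> excess w o = 0.
Proof.
move=> w0; apply/eqP; rewrite eq_le excess_ge0 andbT.
by rewrite -w0; exact: excess_le.
Qed.

Lemma excess_single w o : (forall j, j != o -> set_val w (pt j) = 0) ->
  excess w o = set_val w (pt o).
Proof.
move=> w0; rewrite /excess (bigD1 o) //= [X in _ - (_ + X)]big1 => [|j /w0 //].
have := splx_ge0 w (pt o) => w1; rewrite max_r; lra.
Qed.

Lemma excess_continuous o : continuous (fun w => excess w o).
Proof. rewrite /excess; rcont. Qed.

Lemma splx_book_sum w : set_val w None + (set_val w (Some None) +
  \sum_o set_val w (pt o)) = 1.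
Proof. by rewrite -(splx_sum w) !big_option_sum. Qed.

Lemma splx_book_bounds w o : set_val w None + set_val w (pt o) <= 1.
Proof.
have := splx_book_sum w; rewrite (bigD1 o) //=.
have : 0 <= \sum_(j | j != o) set_val w (pt j).
  by apply: sumr_ge0 => j _; exact: splx_ge0.
by have := splx_ge0 w (Some None); lra.
Qed.

Lemma splx_book_None w : set_val w None <= 1.
Proof.
have := splx_book_sum w.
have : 0 <= \sum_j set_val w (pt j).
  by apply: sumr_ge0 => j _; exact: splx_ge0.
by have := splx_ge0 w (Some None); lra.
Qed.

(** Coordinates in the triangle v e s_o: the weight at v is kept, the excess stays at s_o, and
    everything else goes to e^*. This is a point of the triangle for every [w], so that pages can be
    pasted as maps defined on the whole simplex. *)
Definition page_fun w o (k : option bool) : R :=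
  match k with
  | None => excess w o
  | Some false => set_val w None
  | Some true => 1 - set_val w None - excess w o
  end.

Lemma page_splx w o : splx R (option bool) (page_fun w o).
Proof.
split; last by rewrite big_option_sum big_bool /=; ring.
case=> [[]|] /=; rewrite ?excess_ge0 ?splx_ge0 //.
by have := splx_book_bounds w o; have := excess_le w o; lra.
Qed.

Definition page w o : splx R (option bool) := in_body (page_splx w o).

Definition spine_fun w (k : bool) : R :=
  if k then 1 - set_val w None else set_val w None.

Lemma spine_splx w : splx R bool (spine_fun w).
Proof.
split; last by rewrite big_bool /=; ring.
case=> /=; rewrite ?splx_ge0 //; have := splx_book_None w; lra.
Qed.

Definition spine w : splx R bool := in_body (spine_splx w).

Lemma pageE w o k : set_val (page w o) k = page_fun w o k. Proof. by []. Qed.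

Lemma spineE w k : set_val (spine w) k = spine_fun w k. Proof. by []. Qed.

(** The point given by [page] or [spine], in the coordinates of the whole simplex, where it can be
    joined to [w] by a segment. *)
Definition retract_fun w (k : option (option A)) : R :=
  match k with
  | None => set_val w None
  | Some None => 1 - set_val w None - \sum_o excess w o
  | Some (Some o) => excess w o
  end.

Lemma retract_splx w : splx R (option (option A)) (retract_fun w).
Proof.
split; last by rewrite !big_option_sum /=; ring.
case=> [[a|]|] /=; rewrite ?excess_ge0 ?splx_ge0 //.
have : \sum_o excess w o <= \sum_o set_val w (pt o).
  by apply: ler_sum => o _; exact: excess_le.
by have := splx_book_sum w; have := splx_ge0 w (Some None); lra.
Qed.

Definition retract w : splx R (option (option A)) := in_body (retract_splx w).

Lemma retractE w k : set_val (retract w) k = retract_fun w k.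
Proof. by []. Qed.

Lemma page_continuous o : continuous (fun w => page w o).
Proof.
have ce := @excess_continuous o.
by apply: in_body_continuous => -[[]|]; rewrite /page_fun; rcont.
Qed.

Lemma spine_continuous : continuous spine.
Proof. by apply: in_body_continuous => -[]; rewrite /spine_fun; rcont. Qed.

Lemma retract_continuous : continuous retract.
Proof.
have ce := excess_continuous.
by apply: in_body_continuous => -[[a|]|]; rewrite /retract_fun; rcont.
Qed.

End Excess.

(** * The map on X^* induced by a family on X^ *)

Section Book.
Variables (R : realType) (X : vh_complex) (U : topologicalType).
Variable Phi : forall t : hat_simplex X, splx R (hat_vtx t) -> U.
Arguments Phi : clear implicits.
Hypothesis PhiP : face_compatible Phi.

Lemma adjacent_sidesP (e : vedge X) (o : adjacent_sides e) :
  vside_edge (val o) = e.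
Proof.
have : val o \in adjacent_sides e by exact: fsvalP.
move: (val o) => {}o; rewrite /adjacent_sides.
have [fin|nfin] := pselect (finite_set [set o : vside X | vside_edge o = e]).
  by rewrite in_fset_set // inE.
(* On an infinite set [fset_set] is empty by default, so there is no such [o]. *)
by rewrite /fset_set; case: pselect.
Qed.

Definition page_simplex (e : vedge X) (b : bool) (o : adjacent_sides e) :=
  HatVTriangle (val o) (b (+) side_flip (val (val o))).

(** Where no excess is positive the point goes to the half edge; this includes the case of an edge
    without adjacent squares. By [page_spine] the branches agree where they meet. *)
Definition book (e : vedge X) (b : bool)
    (w : splx R (option (option (adjacent_sides e)))) : U :=
  if [pick o | 0 < excess w o] is Some o
  then Phi (page_simplex b o) (page w o)
  else Phi (HatHalf e b) (spine w).

Lemma page_spine (e : vedge X) b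
    (w : splx R (option (option (adjacent_sides e)))) (o : adjacent_sides e) :
  excess w o = 0 ->
  Phi (page_simplex b o) (page w o) = Phi (HatHalf e b) (spine w).
Proof.
move=> w0; rewrite (@Phi_vtri_half _ _ _ _ PhiP _ _ _ (spine w)) //.
by rewrite -addbA addbb addbF adjacent_sidesP.
Qed.

Lemma book_spine (e : vedge X) b
    (w : splx R (option (option (adjacent_sides e)))) :
  (forall j, excess w j = 0) ->
  book b w = Phi (HatHalf e b) (spine w).
Proof.
by move=> w0; rewrite /book; case: pickP => // o; rewrite w0 ltxx.
Qed.

(** The excess of [o] itself may vanish: the hypothesis is a closed condition on [w], as pasting
    requires. *)
Lemma book_page (e : vedge X) b
    (w : splx R (option (option (adjacent_sides e)))) (o : adjacent_sides e) :
  (forall j, j != o -> excess w j = 0) ->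
  book b w = Phi (page_simplex b o) (page w o).
Proof.
move=> w0; rewrite /book; case: pickP => [a wa|wo].
  have [-> //|ao] := eqVneq a o.
  by move: wa; rewrite w0 // ltxx.
rewrite page_spine //; apply/eqP; rewrite eq_le excess_ge0 andbT.
by rewrite leNgt wo.
Qed.

Lemma book_cases (e : vedge X) (w : splx R (option (option (adjacent_sides e)))) :
  (forall j, excess w j = 0) \/
  exists o, forall j, j != o -> excess w j = 0.
Proof.
case: (pickP (fun o => 0 < excess w o)) => [a wo|wo]; [right; exists a|left].
  move=> j jo; apply/eqP; rewrite eq_le excess_ge0 andbT leNgt.
  by apply: contra jo => /excess_uniq /(_ wo) ->.
by move=> j; apply/eqP; rewrite eq_le excess_ge0 andbT leNgt wo.
Qed.

(** Without weight at v, a page of [w] lies on the spoke from e^* to a centre and the spine of [w]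
    is e^*, and neither depends on the end of [e]. Hence the maps on the two attached simplices
    agree on their common face. *)
Lemma book_end (e : vedge X) b b' (w : splx R (option (option (adjacent_sides e)))) :
  set_val w None = 0 -> book b w = book b' w.
Proof.
move=> w0; have [wj|[a wo]] := book_cases w.
  by rewrite !book_spine //; exact: Phi_half_mid.
by rewrite !(book_page _ wo); exact: Phi_vtri_mid.
Qed.

Lemma book_half (e : vedge X) b w : book b (push (@half_in_sigma (adjacent_sides e)) w) =
  Phi (HatHalf e b) w.
Proof.
have hI : injective (@half_in_sigma (adjacent_sides e)) by case=> -[].
rewrite book_spine => [|j]; last by apply: excess0; rewrite push_out // => -[].
congr Phi; apply: splx_eq => k; rewrite spineE /spine_fun.
have := push_inj w false hI => /= ->.
by case: k; rewrite ?splx_bool //; ring.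
Qed.

Lemma book_triangle (e : vedge X) b (o : adjacent_sides e) w :
  book b (push (triangle_in_sigma o) w) = Phi (page_simplex b o) w.
Proof.
have hI : injective (triangle_in_sigma o) by case=> [[]|] [[]|].
have w0 j : j != o -> set_val (push (triangle_in_sigma o) w) (Some (Some j)) = 0.
  by move=> jo; rewrite push_out // => -[[]|] // [oj]; rewrite oj eqxx in jo.
rewrite (@book_page _ _ _ o) => [|j /w0]; last exact: excess0.
have wn : excess (push (triangle_in_sigma o) w) o = set_val w None.
  by rewrite excess_single //; exact: (push_inj w None hI).
congr Phi; apply: splx_eq => k; rewrite pageE /page_fun.
have /= -> := push_inj w (Some false) hI; rewrite wn.
by case: k => [[]|] //; rewrite splx_option_bool; ring.
Qed.

(* The choice of the end [false] on the common face is immaterial: [book_end]. *)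
Definition star_map (t : star_simplex X) : splx R (star_vtx t) -> U :=
  match t with
  | StarHat t => Phi t
  | StarSigma e b => @book e b
  | StarCommon e => fun w => book false (push Some w)
  end.

Lemma star_map_face (s : star_simplex X) p
    (w : splx R (star_vtx (projT1 p))) : @star_face_maps X s p ->
  @star_map (projT1 p) w = @star_map s (push (projT2 p) w).
Proof.
case: s p w => [s|e b|e] p w //=.
- by case=> q qs E; move: w; rewrite -E => w /=; exact: PhiP.
- move=> h; move: w; case: h => [[->|->]|[a _ <-]] w /=.
  + by apply: book_end; rewrite push_out.
  + by rewrite book_half.
  + by rewrite book_triangle.
Qed.

Hypothesis Phi_cont : forall t, continuous (Phi t).

Lemma book_continuous (e : vedge X) b : continuous (@book e b).
Proof.
pose h (i : option (adjacent_sides e)) w :=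
  if i is Some o then Phi (page_simplex b o) (page w o)
  else Phi (HatHalf e b) (spine w).
(* A finite closed cover: for each side, the set where all other excesses vanish, and, for [None],
   the set where all of them vanish. *)
apply: (@paste_continuous _ _ _ (fun i : option (adjacent_sides e) =>
  [set w | forall j, i != Some j -> excess w j = 0]) h) => [i|[a|]|w|[a|] w w0].
- rewrite (_ : mkset _ = \bigcap_(j in [set j | i != Some j])
    ((fun w => excess w j) @^-1` [set 0])); last by apply/seteqP; split=> w.
  apply: closed_bigI => j _; have /continuous_closedP := @excess_continuous R _ j.
  by apply; exact: closed_eq.
- move=> w; apply: (@continuous_comp _ _ _ (fun w => page w a)).
    exact: page_continuous.
  exact: Phi_cont.
- move=> w; apply: (@continuous_comp _ _ _ (@spine _ _)).
    exact: spine_continuous.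
  exact: Phi_cont.
- have [w0|[a wo]] := book_cases w; first by exists None => j _; exact: w0.
  by exists (Some a) => j jo; apply: wo; apply: contra jo => /eqP ->.
- by apply: book_page => j jo; apply: w0; apply: contra jo => /eqP[->].
- by apply: book_spine => j; exact: w0.
Qed.

Lemma push_continuous (K L : finType) (f : K -> L) : continuous (@push R K L f).
Proof.
apply: in_body_continuous => l.
rewrite (_ : (fun w => _) = fun w : splx R K =>
    \sum_k if f k == l then set_val w k else 0); last first.
  by apply/funext => w; rewrite -big_mkcond.
by apply: continuous_sumr => k; case: (f k == l); rcont.
Qed.

Lemma star_map_continuous t : continuous (@star_map t).
Proof.
case: t => [t|e b|e] /=; [exact: Phi_cont|exact: book_continuous|] => w.
apply: (@continuous_comp _ _ _ (@push R _ _ Some)).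
  exact: push_continuous.
exact: book_continuous.
Qed.

End Book.

(** * Subdivision of squares *)

Section Squares.
Variables (R : realType) (X : vh_complex).

(* The coordinate which is constant on the vertical sides of s. *)
Definition vdir (s : square X) : bool := vertical (side s true false).

Lemma vertical_vdir s d b : vertical (side s d b) = (d == vdir s).
Proof.
have hf b' : vertical (side s false b') = ~~ vdir s 
  by have /= -> := Defs.alternating s true false b'.
case: d; last by rewrite hf; case: vdir.
have := Defs.alternating s false false b; rewrite /= hf negbK => ->.
by case: vdir.
Qed.

Lemma vdirP s b : vertical (side s (vdir s) b).
Proof. by rewrite vertical_vdir eqxx. Qed.

Lemma hdirP s b : ~~ vertical (side s (~~ vdir s) b).
Proof. by rewrite vertical_vdir; case: vdir. Qed.

Definition vside_at (s : square X) (b : bool) : vside X :=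
  exist _ (s, vdir s, b) (vdirP s b).

Definition hside_at (s : square X) (b : bool) : hside X :=
  exist _ (s, ~~ vdir s, b) (hdirP s b).

Lemma vside_atE (o : vside X) : o = vside_at (side_square (val o)) (val o).2.
Proof.
apply: val_inj; case: o => -[[s d] b] /= h; congr (_, _, _).
by apply/eqP; rewrite -(vertical_vdir s d b).
Qed.

Lemma hside_atE (o : hside X) : o = hside_at (side_square (val o)) (val o).2.
Proof.
apply: val_inj; case: o => -[[s d] b] /= h; congr (_, _, _).
by move: h; rewrite vertical_vdir; case: d; case: vdir.
Qed.

Lemma corner_pos_side d b c k :
  corner_pos R (side_corner d b c) k = (if k == d then b else c)%:R.
Proof. by case: d; case: k. Qed.

(** Rescaled to [-1, 1], so that midpoints and centres are at 0 and the subdivision is symmetric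
    under changes of sign. *)
Definition centred (K : finType) (k : K) (x : @cube R K) : R :=
  2 * set_val x k - 1.

Lemma cube_ge0 (K : finType) (x : @cube R K) k : 0 <= set_val x k.
Proof. by have h := set_valP x; have /andP[] := h k. Qed.

Lemma cube_le1 (K : finType) (x : @cube R K) k : set_val x k <= 1.
Proof. by have h := set_valP x; have /andP[] := h k. Qed.

Lemma centred_norm (K : finType) (k : K) x : `|centred k x| <= 1.
Proof.
have := cube_ge0 x k; have := cube_le1 x k; rewrite /centred ler_norml.
by move=> ? ?; apply/andP; split; lra.
Qed.

Lemma centred_continuous (K : finType) (k : K) : continuous (centred k).
Proof. rewrite /centred; rcont. Qed.

Definition signed (b : bool) (u : R) : R := if b then u else - u.

Lemma signed_sign u : 0 <= signed (0 <= u) u.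
Proof. by rewrite /signed; case: ifP => // /negbT; rewrite -ltNge; lra. Qed.

Lemma signed_norm b u : 0 <= signed b u -> `|u| = signed b u.
Proof.
by case: b => /= ?; [rewrite ger0_norm|rewrite ler0_norm //; lra].
Qed.

(** On a half edge |u| runs from 0 at e^* to 1 at the end of the edge, so it is the weight at that
    end. *)
Definition half_fun (u : R) (k : bool) : R := if k then 1 - `|u| else `|u|.

Lemma half_splx (x : @cube R unit) : splx R bool (half_fun (centred tt x)).
Proof.
split; last by rewrite big_bool /=; ring.
by case=> /=; rewrite ?normr_ge0 // subr_ge0 centred_norm.
Qed.

Definition half_coord x : splx R bool := in_body (half_splx x).

Definition segment_fun (u : R) (k : bool) : R := if k then u else 1 - u.

Lemma segment_splx (x : @cube R unit) : splx R bool (segment_fun (set_val x tt)).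
Proof.
split; last by rewrite big_bool /=; ring.
by case; rewrite /segment_fun ?subr_ge0 ?cube_ge0 ?cube_le1.
Qed.

Definition segment_coord x : splx R bool := in_body (segment_splx x).

(* Barycentric coordinates in the triangles of a square with coordinates u, v in
   [-1, 1], where u is constant on the vertical sides.  They are meant for
   |v| <= |u| and |u| <= |v| respectively; the minimum and the clamping keep the
   values in the simplex on the whole square. *)
Definition vtri_fun (u v : R) (k : option bool) : R :=
  match k with
  | None => 1 - `|u|
  | Some true => `|u| - Num.min `|u| `|v|
  | Some false => Num.min `|u| `|v|
  end.

Lemma vtri_splx d (x : @cube R bool) :
  splx R (option bool) (vtri_fun (centred d x) (centred (~~ d) x)).
Proof.
split; last by rewrite big_option_sum big_bool /=; ring.
have h := centred_norm d x.
by case=> [[]|]; rewrite /vtri_fun ?subr_ge0 ?ge_min ?lexx ?le_min ?normr_ge0.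
Qed.

Definition vtri_coord d x : splx R (option bool) := in_body (vtri_splx d x).

Definition htri_fun (u v : R) (k : option bool) : R :=
  match k with
  | None => 1 - `|v|
  | Some c => (`|v| + signed c (Num.max (- `|v|) (Num.min u `|v|))) / 2
  end.

Lemma htri_clamp (u v : R) : `|u| <= `|v| ->
  Num.max (- `|v|) (Num.min u `|v|) = u.
Proof. by rewrite ler_norml => /andP[h1 h2]; rewrite min_l ?max_r. Qed.

Lemma htri_splx d (x : @cube R bool) :
  splx R (option bool) (htri_fun (centred d x) (centred (~~ d) x)).
Proof.
split; last by rewrite big_option_sum big_bool /= /signed; lra.
have := centred_norm (~~ d) x; set u := centred d x; set v := `|_|.
have v0 : 0 <= v by exact: normr_ge0.
have h1 : - v <= Num.max (- v) (Num.min u v) by rewrite le_max lexx.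
have h2 : Num.max (- v) (Num.min u v) <= v.
  by rewrite ge_max ge_min lexx orbT andbT; lra.
by move=> v1; case=> [[]|] /=; rewrite -/v /signed; lra.
Qed.

Definition htri_coord d x : splx R (option bool) := in_body (htri_splx d x).

Lemma half_coordE x k : set_val (half_coord x) k = half_fun (centred tt x) k.
Proof. by []. Qed.

Lemma segment_coordE x k :
  set_val (segment_coord x) k = segment_fun (set_val x tt) k.
Proof. by []. Qed.

Lemma triangle_fun_continuous (T : topologicalType) (f g : T -> R) k :
  continuous f -> continuous g ->
  continuous (fun x => vtri_fun (f x) (g x) k) /\
  continuous (fun x => htri_fun (f x) (g x) k).
Proof.
by move=> cf cg; split; case: k => [[]|]; rewrite /vtri_fun /htri_fun /signed;
  rcont.
Qed.

Lemma half_fun_continuous (T : topologicalType) (f : T -> R) k :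
  continuous f -> continuous (fun x => half_fun (f x) k).
Proof. by move=> cf; case: k; rewrite /half_fun; rcont. Qed.

Lemma half_coord_continuous : continuous half_coord.
Proof.
apply: in_body_continuous => k.
by apply: half_fun_continuous; exact: centred_continuous.
Qed.

Lemma segment_coord_continuous : continuous segment_coord.
Proof.
by apply: in_body_continuous => -[];
  rewrite /segment_fun; rcont.
Qed.

Lemma vtri_coord_continuous d : continuous (vtri_coord d).
Proof.
apply: in_body_continuous => k.
by have [] := triangle_fun_continuous k (@centred_continuous _ d)
  (@centred_continuous _ (~~ d)).
Qed.

Lemma htri_coord_continuous d : continuous (htri_coord d).
Proof.
apply: in_body_continuous => k.
by have [] := triangle_fun_continuous k (@centred_continuous _ d)
  (@centred_continuous _ (~~ d)).
Qed.

Lemma closed_ge0 (T : topologicalType) (f : T -> R) :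
  continuous f -> closed [set x | 0 <= f x].
Proof.
move=> /continuous_closedP cf; apply: (cf [set y | 0 <= y]); exact: closed_ge.
Qed.

Lemma signed_continuous (T : topologicalType) b (f : T -> R) :
  continuous f -> continuous (fun x => signed b (f x)).
Proof. by case: b => // cf; apply: continuous_oppr. Qed.

Definition splx1 : splx R unit.
Proof.
by apply: (@in_body _ _ (fun=> 1)); split=> [_|]; rewrite ?big_unit_sum ?ler01.
Defined.

(** * The map on X induced by a family on X^ *)

Section Subdivision.
Variables (U : topologicalType).
Variable Phi : forall t : hat_simplex X, splx R (hat_vtx t) -> U.
Arguments Phi : clear implicits.
Hypothesis PhiP : face_compatible Phi.

Definition vertex_map (v : vertex X) (x : @cube R void) : U :=
  Phi (HatVertex v) splx1.

Definition edge_map (e : edge X) (x : @cube R unit) : U :=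
  match pselect (vertical e) with
  | left h => Phi (HatHalf (exist _ e h) (0 <= centred tt x)) (half_coord x)
  | right h => Phi (HatHEdge (exist _ e (introN idP h))) (segment_coord x)
  end.

(** The six triangles are cut out by the diagonals |u| = |v| and by the line v = 0 through the
    midpoints of the vertical sides. On these walls the branch is arbitrary; [square_map_vtri] and
    [square_map_htri] remove the choice. *)
Definition square_map (s : square X) (x : @cube R bool) : U :=
  let u := centred (vdir s) x in let v := centred (~~ vdir s) x in
  if `|v| <= `|u|
  then Phi (HatVTriangle (vside_at s (0 <= u)) (0 <= v)) (vtri_coord (vdir s) x)
  else Phi (HatHTriangle (hside_at s (0 <= v))) (htri_coord (vdir s) x).

Lemma edge_map_vertical (e : vedge X) b (x : @cube R unit) :
  0 <= signed b (centred tt x) ->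
  edge_map (val e) x = Phi (HatHalf e b) (half_coord x).
Proof.
move=> bx; rewrite /edge_map; case: e => e he /=.
case: pselect => // h.
rewrite (bool_irrelevance h he).
have [-> //|bu] := eqVneq (0 <= centred tt x) b.
have u0 : centred tt x = 0.
  apply/eqP; rewrite eq_le; move: bu bx; case: b => /=.
    by case: (_ <= _).
  by case: leP => //; lra.
by apply: Phi_half_mid => //; rewrite /half_coord set_valE /= /half_fun u0 normr0.
Qed.

Lemma edge_map_horizontal (e : hedge X) (x : @cube R unit) :
  edge_map (val e) x = Phi (HatHEdge e) (segment_coord x).
Proof.
rewrite /edge_map; case: e => e he /=.
case: pselect => h; first by exfalso; apply: (negP he).
by rewrite (bool_irrelevance (introN idP h) he).
Qed.

Lemma vtri_coordE d x k :
  set_val (vtri_coord d x) k = vtri_fun (centred d x) (centred (~~ d) x) k.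
Proof. by []. Qed.

Lemma htri_coordE d x k :
  set_val (htri_coord d x) k = htri_fun (centred d x) (centred (~~ d) x) k.
Proof. by []. Qed.

Lemma signed_other b u : 0 <= signed b u -> (0 <= u) != b -> u = 0.
Proof.
rewrite /signed => bu ub; apply/eqP; rewrite eq_le; move: ub bu.
by case: b => /=; case: leP => //; lra.
Qed.

(** The signs [b] and [c] can differ from those in the definition only where u or v vanishes. If v =
    0 the point lies on the spoke to a midpoint; if u = 0 then v = 0 too, and it is the centre. *)
Lemma square_map_vtri s b c (x : @cube R bool) :
  let u := centred (vdir s) x in let v := centred (~~ vdir s) x in
  `|v| <= `|u| -> 0 <= signed b u -> 0 <= signed c v ->
  square_map s x = Phi (HatVTriangle (vside_at s b) c) (vtri_coord (vdir s) x).
Proof.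
move=> u v vu bu cv; rewrite /square_map -/u -/v vu.
have [->|/(signed_other bu) u0] := eqVneq (0 <= u) b.
  have [-> //|/(signed_other cv) v0] := eqVneq (0 <= v) c.
  apply: Phi_vtri_mid => //.
  rewrite vtri_coordE /= -/v v0 normr0 minEle normr_le0.
  by case: eqP => // ->; rewrite normr0.
have zN : set_val (vtri_coord (vdir s) x) None = 1.
  by rewrite vtri_coordE /= -/u u0 normr0 subr0.
by rewrite !(Phi_vtri_centre PhiP _ _ splx1 zN).
Qed.

(** The definition prefers vertical triangles, so a tie |u| = |v| needs an argument: the point is
    the centre if v = 0, and otherwise lies on a corner spoke, where [Phi_corner] applies. *)
Lemma square_map_htri s c (x : @cube R bool) :
  let u := centred (vdir s) x in let v := centred (~~ vdir s) x in
  `|u| <= `|v| -> 0 <= signed c v ->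
  square_map s x = Phi (HatHTriangle (hside_at s c)) (htri_coord (vdir s) x).
Proof.
move=> u v uv cv; rewrite /square_map -/u -/v.
have zN : v = 0 -> set_val (htri_coord (vdir s) x) None = 1.
  by move=> v0; rewrite htri_coordE /= -/v v0 normr0 subr0.
have u0 : v = 0 -> u = 0.
  by move=> v0; move: uv; rewrite v0 normr0 normr_le0 => /eqP.
have zN' : v = 0 -> set_val (vtri_coord (vdir s) x) None = 1.
  by move=> v0; rewrite vtri_coordE /= -/u u0 // normr0 subr0.
have [v0|v0] := eqVneq v 0.
  case: ifP => _.
    rewrite (Phi_vtri_centre PhiP _ _ splx1 (zN' v0)).
    by rewrite (Phi_htri_centre PhiP _ splx1 (zN v0)).
  rewrite (Phi_htri_centre PhiP _ splx1 (zN v0)).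
  by rewrite (Phi_htri_centre PhiP _ splx1 (zN v0)).
have -> : (0 <= v) = c.
  by apply/eqP/negPn/negP => /(signed_other cv) /eqP; rewrite (negbTE v0).
case: ifP => // vu.
have uvE : `|u| = `|v| by apply/eqP; rewrite eq_le uv vu.
have := signed_norm (signed_sign u).
set b := (0 <= u); move=> bE.
apply: (@Phi_corner _ _ _ _ PhiP (vside_at s b) (hside_at s c) c b) => //.
- by rewrite /side_end /=; case: vdir.
- by rewrite vtri_coordE /= -/u -/v uvE minxx subrr.
- rewrite htri_coordE /htri_fun -/u -/v htri_clamp //.
  by rewrite -uvE bE /signed; case: (b) => /=; ring.
- by rewrite vtri_coordE htri_coordE /= -/u -/v uvE.
Qed.

Lemma vertex_half e b z : set_val z false = 1 ->
  Phi (HatHalf e b) z = Phi (HatVertex (endpoint (val e) b)) splx1.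
Proof.
move=> z1; have := splx_bool z; rewrite z1 => z0.
have [w -> _] := @Phi_face _ _ _ _ PhiP (HatHalf e b)
  (HatVertex (endpoint (val e) b)) (fun=> false) z ltac:(by left)
  ltac:(by case=> -[]) ltac:(by case=> [_|/(_ tt)] //; lra).
by congr Phi; apply: splx_eq => -[]; rewrite !splx_unit.
Qed.

Lemma vertex_hedge e (b : bool) z : set_val z b = 1 ->
  Phi (HatHEdge e) z = Phi (HatVertex (endpoint (val e) b)) splx1.
Proof.
move=> z1; have z0 := splx_bool z.
have zb (l : bool) : (forall _ : unit, b <> l) -> set_val z l = 0.
  by move: z1; case: (b); case: l => // z1 bl; first [by case: (bl tt)|clear bl; lra].
have [w -> _] := @Phi_face _ _ _ _ PhiP (HatHEdge e)
  (HatVertex (endpoint (val e) b)) (fun=> b) z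
  ltac:(by case: (b); [right; left|left])
  ltac:(by case=> -[]) zb.
by congr Phi; apply: splx_eq => -[]; rewrite !splx_unit.
Qed.

Lemma edge_map_end e (b : bool) (x : @cube R unit) : set_val x tt = b%:R ->
  edge_map e x = Phi (HatVertex (endpoint e b)) splx1.
Proof.
move=> xb; have [he|he] := boolP (vertical e).
  have xE : centred tt x = (if b then 1 else -1).
    by rewrite /centred xb; case: (b) => /=; ring.
  rewrite (@edge_map_vertical (exist _ e he) b); last first.
    by rewrite xE /signed; case: (b); lra.
  apply: vertex_half.
  rewrite half_coordE /half_fun xE; case: (b); rewrite ?normrN normr1 //.
rewrite (@edge_map_horizontal (exist _ e he)); apply: vertex_hedge.
by rewrite segment_coordE /segment_fun xb; case: (b) => /=; ring.
Qed.

(** On a side the centred coordinate [d] is 1 or -1, hence dominates the other one: the point lies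
    in a triangle standing on that side, with weight 0 at the centre. *)
Lemma square_map_side s d b (t : @cube R unit) (x : @cube R bool) :
  @side_map R d b (flip s d b) (set_val t) = set_val x ->
  edge_map (side s d b) t = square_map s x.
Proof.
move=> tx; set fl := flip s d b in tx *.
have xd : centred d x = (if b then 1 else -1).
  rewrite /centred -tx /side_map eqxx; case: (b) => /=; ring.
(* Reversing an edge changes the sign of its centred coordinate. *)
have xnd : centred (~~ d) x = signed (~~ fl) (centred tt t).
  rewrite /centred -tx /side_map /signed; case: (d) => /=; case: (fl) => /=; ring.
have xd1 : `|centred d x| = 1 by rewrite xd; case: (b); rewrite ?normrN normr1.
have xdb : 0 <= signed b (centred d x) by rewrite xd /signed; case: (b); lra.
have [dE|dE] := eqVneq d (vdir s).
  subst d; set v := centred (~~ vdir s) x in xnd.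
  rewrite (@square_map_vtri s b (0 <= v)) //; last 2 first.
  - by rewrite xd1 centred_norm.
  - exact: signed_sign.
  rewrite (@Phi_vtri_half _ _ _ _ PhiP _ _ _ (half_coord t)); last 2 first.
  - by rewrite vtri_coordE /= xd1 subrr.
  - rewrite vtri_coordE half_coordE /= xd1 min_r ?centred_norm //.
    by rewrite -/v xnd /signed; case: (fl); rewrite ?normrN.
  apply: (@edge_map_vertical (vside_edge (vside_at s b))).
  have := signed_sign v; rewrite {2}xnd /side_flip /= -/fl /signed.
  by case: (0 <= v); case: (fl) => /=; lra.
have {}dE : d = ~~ vdir s by move: dE; case: (d); case: vdir.
subst d; rewrite negbK in xnd; set u := centred (vdir s) x in xnd.
rewrite (@square_map_htri s b) //; last by rewrite xd1 centred_norm.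
rewrite (@Phi_htri_edge _ _ _ _ PhiP _ _ (segment_coord t)); last 2 first.
- by rewrite htri_coordE /= xd1 subrr.
- rewrite htri_coordE segment_coordE /htri_fun htri_clamp xd1 ?centred_norm //.
  rewrite -/u xnd /side_flip /= -/fl /signed /segment_fun /centred.
  by case: (fl) => /=; field.
exact: (@edge_map_horizontal (hside_edge (hside_at s b))).
Qed.

(** The corner is the end [p.2 (+) fl] of the side [(false, p.1)], which is how [corner] is defined;
    so the claim reduces to that side. *)
Lemma square_map_corner s p (x : @cube R bool) :
  @corner_map R p (fun=> 0) = set_val x ->
  square_map s x = Phi (HatVertex (corner s p)) splx1.
Proof.
move=> px; set fl := flip s false p.1.
have h : @cube R unit (fun=> (p.2 (+) fl)%:R).
  by move=> ?; case: (_ (+) _); rewrite ?lexx ?ler01.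
rewrite -(@square_map_side s false p.1 (in_body h)).
  exact: edge_map_end.
rewrite -px; apply/funext => k; rewrite /side_map /corner_map set_valE /=.
by case: k => //=; rewrite -/fl; case: (p.2); case: (fl) => /=; rewrite ?subrr ?subr0.
Qed.

Definition sq_map (c : sq_cell X) : @cube R (sq_coord c) -> U :=
  match c with
  | VertexCell v => @vertex_map v
  | EdgeCell e => @edge_map e
  | SquareCell s => @square_map s
  end.

Lemma sq_map_glue (c c' : sq_cell X) m (x : @cube R (sq_coord c))
    (y : @cube R (sq_coord c')) :
  @sq_attach R X c (existT _ c' m) -> m (set_val y) = set_val x ->
  sq_map y = sq_map x.
Proof.
(* With the cell and the map packed into the variable [q], the equalities of dependent pairs in
   [sq_attach] can be substituted. *)
suff H (q : {c' : sq_cell X & {ptws sq_coord c' -> R} -> {ptws sq_coord c -> R}})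
    (z : @cube R (sq_coord (projT1 q))) : @sq_attach R X c q ->
    projT2 q (set_val z) = set_val x -> sq_map z = sq_map x.
  by move=> am mx; exact: (H (existT _ c' m)).
clear y m c'; case: c x q z => [v|e|s] x q z //= h; move: z.
  case: h => b -> z /= zx; apply/esym; apply: edge_map_end.
  by rewrite -zx.
case: h => [[d [b ->]]|[p ->]] z /= zx; first exact: square_map_side.
by apply/esym; apply: square_map_corner; rewrite -zx.
Qed.

Hypothesis Phi_cont : forall t, continuous (Phi t).

Lemma edge_map_continuous e : continuous (edge_map e).
Proof.
have [he|he] := boolP (vertical e); last first.
  rewrite (_ : edge_map e = Phi (HatHEdge (exist _ e he)) \o segment_coord).
    move=> x; apply: continuous_comp; last exact: Phi_cont.
    exact: segment_coord_continuous.
  by apply/funext => x; exact: (@edge_map_horizontal (exist _ e he)).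
apply: (@paste_continuous _ _ _ (fun b => [set x | 0 <= signed b (centred tt x)])
  (fun b => Phi (HatHalf (exist _ e he) b) \o half_coord)) => [b|b x|x|b x bx].
- by apply/closed_ge0/signed_continuous/centred_continuous.
- apply: continuous_comp; last exact: Phi_cont.
  exact: half_coord_continuous.
- by exists (0 <= centred tt x); exact: signed_sign.
- exact: (@edge_map_vertical (exist _ e he)).
Qed.

Lemma square_map_continuous s : continuous (square_map s).
Proof.
pose u := centred (vdir s); pose v := centred (~~ vdir s).
(* The six closed triangles: four on the halves of the vertical sides, two on the horizontal
   sides. *)
pose A (i : bool * bool + bool) : set (@cube R bool) :=
  match i with
  | inl (b, c) => [set x | 0 <= `|u x| - `|v x|] `&`
      ([set x | 0 <= signed b (u x)] `&` [set x | 0 <= signed c (v x)])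
  | inr c => [set x | 0 <= `|v x| - `|u x|] `&` [set x | 0 <= signed c (v x)]
  end.
pose h (i : bool * bool + bool) :=
  match i with
  | inl (b, c) => Phi (HatVTriangle (vside_at s b) c) \o vtri_coord (vdir s)
  | inr c => Phi (HatHTriangle (hside_at s c)) \o htri_coord (vdir s)
  end.
have cu : continuous u by exact: centred_continuous.
have cv : continuous v by exact: centred_continuous.
apply: (@paste_continuous _ _ _ A h) => [i|i x|x|i x].
- have cuv : continuous (fun x => `|u x| - `|v x|) by rcont.
  have cvu : continuous (fun x => `|v x| - `|u x|) by rcont.
  case: i => [[b c]|c] /=; repeat apply: closedI; apply: closed_ge0 => //;
    exact: signed_continuous.
- case: i => [[b c]|c] /=; (apply: continuous_comp; last exact: Phi_cont).
    exact: vtri_coord_continuous.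
  exact: htri_coord_continuous.
- have [vu|uv] := leP (`|v x|) (`|u x|).
    exists (inl (0 <= u x, 0 <= v x)); rewrite /= subr_ge0; split=> //.
    by split; exact: signed_sign.
  by exists (inr (0 <= v x)); rewrite /= subr_ge0; split; [exact: ltW|exact: signed_sign].
- case: i => [[b c]|c] /= []; rewrite subr_ge0.
    by move=> vu [bu cv']; exact: square_map_vtri.
  by move=> uv cv'; exact: square_map_htri.
Qed.

Lemma sq_map_continuous c : continuous (@sq_map c).
Proof.
case: c => [v|e|s] /=.
- exact: (@cst_continuous _ _ (Phi (HatVertex v) splx1)).
- exact: edge_map_continuous.
- exact: square_map_continuous.
Qed.

End Subdivision.
End Squares.

(** * The homotopy equivalence *)

Section Inverse.
Variables (R : realType) (X : vh_complex).

Lemma neg_vdir b : (~~ b == b) = false. Proof. by case: b. Qed.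

Lemma eq_vdir b : (b == ~~ b) = false. Proof. by case: b. Qed.

Lemma hat_to_sqE t (w : splx R (hat_vtx t)) (x : @cube R (sq_coord (carrier t))) :
  (forall k, \sum_i set_val w i * @pos R X t i k = set_val x k) ->
  hat_to_sq w = sqcls x.
Proof.
move=> wx; rewrite /hat_to_sq; congr sqcls; apply: val_inj.
by apply/funext => k; exact: wx.
Qed.

Lemma sq_map_hat_to_sq c (x : @cube R (sq_coord c)) :
  sq_map (@hat_to_sq R X) x = sqcls x.
Proof.
case: c x => [v|e|s] x /=.
- by apply: (@hat_to_sqE (HatVertex v)) => -[].
- have [he|he] := boolP (vertical e).
    have bx := signed_sign (centred tt x).
    rewrite (@edge_map_vertical _ _ _ _ (@hat_to_sq_face R X) (exist _ e he) _ _ bx).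
    apply: (@hat_to_sqE (HatHalf (exist _ e he) _)) => -[].
    rewrite big_bool /= !half_coordE /half_fun (signed_norm bx) /centred /signed.
    by case: (_ <= _) => /=; field.
  rewrite (@edge_map_horizontal _ _ _ _ (exist _ e he)).
  apply: (@hat_to_sqE (HatHEdge (exist _ e he))) => -[].
  by rewrite big_bool /= !segment_coordE /segment_fun; ring.
set u := centred (vdir s) x; set v := centred (~~ vdir s) x.
have bu : 0 <= signed (0 <= u) u by exact: signed_sign.
have cv : 0 <= signed (0 <= v) v by exact: signed_sign.
have uE : set_val x (vdir s) = (u + 1) / 2 by rewrite /u /centred; field.
have vE : set_val x (~~ vdir s) = (v + 1) / 2 by rewrite /v /centred; field.
have xE k : set_val x k = if k == vdir s then (u + 1) / 2 else (v + 1) / 2.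
  rewrite -uE -vE; case: eqP => [-> //|]; by case: k; case: vdir.
have [vu|/ltW uv] := leP (`|v|) (`|u|).
  rewrite (square_map_vtri (@hat_to_sq_face R X) vu bu cv).
  apply: (@hat_to_sqE (HatVTriangle (vside_at s _) _)) => k.
  rewrite big_option_sum big_bool /= !vtri_coordE /= -/u -/v min_r // xE.
  rewrite /side_end corner_pos_side /mid_pos /=.
  rewrite (signed_norm bu) (signed_norm cv) /signed.
  by case: (k == _); case: (0 <= u); case: (0 <= v) => /=; field.
rewrite (square_map_htri (@hat_to_sq_face R X) uv cv).
apply: (@hat_to_sqE (HatHTriangle (hside_at s _))) => k.
rewrite big_option_sum big_bool /= !htri_coordE /htri_fun -/u -/v htri_clamp // xE.
rewrite /side_end !corner_pos_side /=.
have -> : (k == ~~ vdir s) = ~~ (k == vdir s) by case: k; case: vdir.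
rewrite (signed_norm cv) /signed.
by case: (k == _); case: (0 <= v) => /=; field.
Qed.

Variables (U : topologicalType).
Variable Phi : forall t : hat_simplex X, splx R (hat_vtx t) -> U.
Arguments Phi : clear implicits.
Hypothesis PhiP : face_compatible Phi.

Definition sq_lift : realisation (sq_gluing R X) -> U :=
  @glue_lift R (sq_gluing R X) U (fun c => @sq_map R X U Phi c).

Lemma sq_liftE c (x : @cube R (sq_coord c)) : sq_lift (sqcls x) = sq_map Phi x.
Proof. by apply: glue_lift_cls => c1 c2 m y z; exact: sq_map_glue. Qed.

(** Both families respect faces, so an identity known on a simplex passes to its faces. This spares
    the computation for midpoints, centres and spokes. *)
Lemma sq_lift_face s p (w : splx R (hat_vtx (projT1 p))) :
  List.In p (hat_faces s) ->
  (forall z, sq_lift (@hat_to_sq R X s z) = Phi s z) ->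
  sq_lift (hat_to_sq w) = Phi (projT1 p) w.
Proof. by move=> ps sP; rewrite (hat_to_sq_face w ps) sP (PhiP w ps). Qed.

Lemma sq_lift_hat_to_sq t w : sq_lift (@hat_to_sq R X t w) = Phi t w.
Proof.
have vP o c z : sq_lift (@hat_to_sq R X (HatVTriangle o c) z) =
    Phi (HatVTriangle o c) z.
  move: z; rewrite (vside_atE o); move: (side_square _) (val o).2 => s b z.
  rewrite sq_liftE /=; set x := in_body _.
  have xE k : set_val x k = \sum_i set_val z i *
    @pos R X (HatVTriangle (vside_at s b) c) i k by [].
  have zs := splx_option_bool z.
  have z0 := splx_ge0 z (Some false); have z1 := splx_ge0 z (Some true).
  (* The factor 2 b - 1 is the value of u on the side: u is constant on the edge opposite to the
     centre, where it is 0. *)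
  have uE : centred (vdir s) x = (2 * b%:R - 1) * (1 - set_val z None).
    rewrite /centred xE big_option_sum big_bool /= /side_end corner_pos_side.
    by rewrite /mid_pos /= eqxx zs; field.
  have vE : centred (~~ vdir s) x = (2 * c%:R - 1) * set_val z (Some false).
    rewrite /centred xE big_option_sum big_bool /= /side_end corner_pos_side.
    by rewrite /mid_pos /= neg_vdir zs; field.
  have uB : 0 <= signed b (centred (vdir s) x).
    by rewrite uE /signed; case: (b) => /=; lra.
  have vB : 0 <= signed c (centred (~~ vdir s) x).
    by rewrite vE /signed; case: (c) => /=; lra.
  have uA : `|centred (vdir s) x| = 1 - set_val z None.
    by rewrite (signed_norm uB) uE /signed; case: (b) => /=; ring.
  have vA : `|centred (~~ vdir s) x| = set_val z (Some false).
    by rewrite (signed_norm vB) vE /signed; case: (c) => /=; ring.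
  have vu : `|centred (~~ vdir s) x| <= `|centred (vdir s) x|.
    by rewrite uA vA; lra.
  rewrite (square_map_vtri PhiP vu uB vB); congr Phi; apply: splx_eq => k.
  rewrite vtri_coordE /vtri_fun min_r // uA vA.
  by case: k => [[]|] //; rewrite ?zs; ring.
have hP o z : sq_lift (@hat_to_sq R X (HatHTriangle o) z) =
    Phi (HatHTriangle o) z.
  move: z; rewrite (hside_atE o); move: (side_square _) (val o).2 => s b z.
  rewrite sq_liftE /=; set x := in_body _.
  have xE k : set_val x k = \sum_i set_val z i *
    @pos R X (HatHTriangle (hside_at s b)) i k by [].
  have zs := splx_option_bool z.
  have z0 := splx_ge0 z (Some false); have z1 := splx_ge0 z (Some true).
  have zN := splx_ge0 z None.
  have uE : centred (vdir s) x = set_val z (Some true) - set_val z (Some false).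
    rewrite /centred xE big_option_sum big_bool /= /side_end !corner_pos_side.
    by rewrite eq_vdir /= zs; field.
  have vE : centred (~~ vdir s) x = (2 * b%:R - 1) * (1 - set_val z None).
    rewrite /centred xE big_option_sum big_bool /= /side_end !corner_pos_side.
    by rewrite eqxx /= zs; field.
  have vB : 0 <= signed b (centred (~~ vdir s) x).
    by rewrite vE /signed; case: (b) => /=; lra.
  have vA : `|centred (~~ vdir s) x| = 1 - set_val z None.
    by rewrite (signed_norm vB) vE /signed; case: (b) => /=; ring.
  have uv : `|centred (vdir s) x| <= `|centred (~~ vdir s) x|.
    by rewrite vA uE ler_norml; apply/andP; split; lra.
  rewrite (square_map_htri PhiP uv vB); congr Phi; apply: splx_eq => k.
  rewrite htri_coordE /htri_fun htri_clamp // uE vA.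
  by case: k => [[]|] /=; rewrite ?zs /signed; field.
have eP e b z : sq_lift (@hat_to_sq R X (HatHalf e b) z) = Phi (HatHalf e b) z.
  rewrite sq_liftE /=; set x := in_body _.
  have xE : set_val x tt = \sum_i set_val z i * @pos R X (HatHalf e b) i tt.
    by [].
  have zs := splx_bool z; have z0 := splx_ge0 z false.
  have uE : centred tt x = (2 * b%:R - 1) * set_val z false.
    by rewrite /centred xE big_bool /= zs; field.
  have uB : 0 <= signed b (centred tt x).
    by rewrite uE /signed; case: (b) => /=; lra.
  rewrite (edge_map_vertical PhiP e uB); congr Phi; apply: splx_eq => k.
  rewrite half_coordE /half_fun (signed_norm uB) uE /signed.
  by case: k; case: (b) => /=; rewrite ?zs; ring.
case: t w => [v|e|s|e|e b|s p|o|o|o c] w.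
- rewrite sq_liftE /= /vertex_map; congr Phi.
  by apply: splx_eq => -[]; rewrite !splx_unit.
- by apply: (@sq_lift_face (HatHalf e true) (hat_face _)) => //; right; left.
- apply: (@sq_lift_face (HatVTriangle (vside_at s true) true) (hat_face _)) => //.
  by do 2 right; left.
- rewrite sq_liftE /= edge_map_horizontal; congr Phi; apply: splx_eq => k.
  rewrite segment_coordE /segment_fun.
  have -> : set_val (in_body (barycentre_cube w (@pos_cube R X (HatHEdge e)))) tt =
    \sum_i set_val w i * @pos R X (HatHEdge e) i tt by [].
  by rewrite big_bool /= mulr1 mulr0 addr0; case: k => //; rewrite splx_bool.
- exact: eP.
(* The vertical side through the corner [p], and the end of that side at which [p] lies. *)
- pose c := if vdir s then p.1 else p.2; pose b := if vdir s then p.2 else p.1.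
  have pE : p = side_end (val (vside_at s b)) c.
    by rewrite /side_end /= /c /b; case: (p) => p1 p2; case: vdir.
  move: w; rewrite [p]pE => w.
  apply: (@sq_lift_face (HatVTriangle (vside_at s b) c) (hat_face _)) => //.
  by do 4 right; left.
- by apply: (@sq_lift_face (HatVTriangle o true) (hat_face _)) => //; do 5 right; left.
- exact: hP.
- exact: vP.
Qed.

Hypothesis Phi_cont : forall t, continuous (Phi t).

Lemma sq_lift_continuous : continuous sq_lift.
Proof.
apply: realisation_continuous => c.
rewrite (_ : (fun x => _) = @sq_map R X U Phi c); first exact: sq_map_continuous.
by apply/funext => x; exact: sq_liftE.
Qed.

End Inverse.

(** * The homotopy on X^* and the two composites *)

Section HomotopyEquivalence.
Variables (R : realType) (X : vh_complex).

Local Notation SX := (realisation (sq_gluing R X)).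
Local Notation KX := (realisation (simp_gluing R (simplexification X))).

Definition star_cls (t : star_simplex X) (w : splx R (star_vtx t)) : KX :=
  @cls R (simp_gluing R (simplexification X)) t w.

Definition hat_cls (t : hat_simplex X) (w : splx R (hat_vtx t)) : KX :=
  star_cls (t := StarHat t) w.

Lemma star_cls_face (s : star_simplex X) p (w : splx R (star_vtx (projT1 p))) :
  @star_face_maps X s p -> star_cls w = star_cls (push (projT2 p) w).
Proof.
move=> ps; apply: (@cls_glue R (simp_gluing R (simplexification X)) _ _
  (simplex_map (projT2 p))) => //.
by exists p.
Qed.

Lemma hat_cls_face : face_compatible hat_cls.
Proof.
move=> s p w ps; apply: (@star_cls_face (StarHat s)
  (star_face (t := StarHat (projT1 p)) (projT2 p))).
by exists p.
Qed.

Lemma star_cls_continuous t : continuous (@star_cls t).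
Proof. exact: (@cls_continuous R (simp_gluing R (simplexification X)) t). Qed.

Definition star_lift (U : Type) (F : forall t, splx R (star_vtx t) -> U) :
    KX -> U :=
  @glue_lift R (simp_gluing R (simplexification X)) U F.

Lemma star_liftE (U : Type) (F : forall t, splx R (star_vtx t) -> U) :
  (forall (s : star_simplex X) p (w : splx R (star_vtx (projT1 p))),
    @star_face_maps X s p -> F _ w = F _ (push (projT2 p) w)) ->
  forall t w, star_lift F (@star_cls t w) = F t w.
Proof.
move=> FP t w; apply: glue_lift_cls => {t w} s t m x y tm mx.
suff H (q : {t : star_simplex X & {ptws star_vtx t -> R} -> {ptws star_vtx s -> R}})
    (z : splx R (star_vtx (projT1 q))) :
    attach (simp_gluing R (simplexification X)) s q ->
    projT2 q (set_val z) = set_val x -> F _ z = F s x.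
  exact: (H (existT _ t m)).
case=> p ps pq; move: z; rewrite -pq => z zx; rewrite (FP s p z ps).
by congr F; apply: val_inj.
Qed.

(** The half edge and the triangles of X^ are glued to faces of the attached simplex, and a page or
    spine pushed into it is [retract w]. So on this simplex the composite X^* -> X -> X^* is the
    retraction. *)
Lemma book_hat_cls (e : vedge X) b (w : splx R (star_vtx (StarSigma e b))) :
  book hat_cls b w = star_cls (t := StarSigma e b) (retract w).
Proof.
have hI : injective (@half_in_sigma (adjacent_sides e)) by case=> -[].
have [w0|[a wa]] := book_cases w.
  rewrite book_spine // /hat_cls (@star_cls_face (StarSigma e b) (star_face
    (t := StarHat (HatHalf e b)) (@half_in_sigma _))) /=; last by left; right.
  congr star_cls; apply: splx_eq => k; rewrite retractE.
  case: k => [[a|]|] /=; first by rewrite w0 push_out // => -[].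
  - rewrite big1 // subr0; exact: (push_inj (spine w) true hI).
  - exact: (push_inj (spine w) false hI).
have tI : injective (triangle_in_sigma a) by case=> [[]|] [[]|].
rewrite (book_page hat_cls_face _ wa) /hat_cls (@star_cls_face (StarSigma e b)
    (star_face (t := StarHat (page_simplex b a)) (triangle_in_sigma a))) /=;
  last by right; exists a.
congr star_cls; apply: splx_eq => k; rewrite retractE.
case: k => [[j|]|] /=; last exact: (push_inj (page w a) (Some false) tI).
  have [->|ja] := eqVneq j a; first exact: (push_inj (page w a) None tI).
  by rewrite wa // push_out // => -[[]|] // [aj]; rewrite aj eqxx in ja.
rewrite (bigD1 a) //= big1 ?addr0 //.
exact: (push_inj (page w a) (Some true) tI).
Qed.

Definition mix (K : finType) (t : R) (w w' : splx R K) : {ptws K -> R} :=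
  fun k => (1 - t) * set_val w k + t * set_val w' k.

(** Descent of homotopies to a realisation is available for products with all of R, so the segment
    is extended to all times by clamping. *)
Definition clamp (t : R) : R := Num.max 0 (Num.min t 1).

Lemma mix_splx (K : finType) t (w w' : splx R K) :
  splx R K (mix (clamp t) w w').
Proof.
have t0 : 0 <= clamp t by rewrite /clamp le_max lexx.
have t1 : clamp t <= 1 by rewrite /clamp ge_max ler01 ge_min lexx orbT.
split=> [k|]; first by apply: addr_ge0; apply: mulr_ge0; rewrite ?splx_ge0 ?subr_ge0.
by rewrite big_split /= -!mulr_sumr !splx_sum; ring.
Qed.

Definition slide (e : vedge X) (b : bool) (t : R)
    (w : splx R (star_vtx (StarSigma e b))) : splx R (star_vtx (StarSigma e b)) :=
  in_body (mix_splx t (retract w) w).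

Lemma slideE e b t w k : set_val (@slide e b t w) k =
  (1 - clamp t) * set_val (retract w) k + clamp t * set_val w k.
Proof. by []. Qed.

(** The homotopy from the retraction at time 0 to the identity at time 1. On the common face the end
    [false] is immaterial by [star_cls_end]. *)
Definition slide_map (t : R) (s : star_simplex X) : splx R (star_vtx s) -> KX :=
  match s with
  | StarHat q => @hat_cls q
  | StarSigma e b => fun w => star_cls (t := StarSigma e b) (slide t w)
  | StarCommon e => fun w => star_cls (t := StarSigma e false)
      (slide (b := false) t (push Some w))
  end.

Lemma star_cls_end (e : vedge X) b b' (w : splx R (option (option (adjacent_sides e)))) :
  set_val w None = 0 ->
  star_cls (t := StarSigma e b) w = star_cls (t := StarSigma e b') w.
Proof.
move=> w0; have sI : injective (@Some (option (adjacent_sides e))) by move=> ? ? [].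
have [|z -> _] := splx_supported (z := w) sI.
  by case=> [k /(_ k)|].
rewrite -(@star_cls_face (StarSigma e b) (star_face (t := StarCommon e) Some)) /=.
  rewrite -(@star_cls_face (StarSigma e b') (star_face (t := StarCommon e) Some)) //.
  by left; left.
by left; left.
Qed.

Lemma retract_id (e : vedge X) (w : splx R (option (option (adjacent_sides e)))) :
  (forall j, excess w j = set_val w (Some (Some j))) -> retract w = w.
Proof.
move=> ej; apply: splx_eq => k; rewrite retractE.
case: k => [[j|]|] //=; under eq_bigr do rewrite ej.
by rewrite -(splx_book_sum w); ring.
Qed.

(** [retract] fixes the glued half edge and triangles pointwise, so the slide is constant there. It
    also keeps the weight at v, so points of the common face stay in it, where both attached
    simplices give the same class. *)
Lemma slide_map_face t (s : star_simplex X) p (w : splx R (star_vtx (projT1 p))) :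
  @star_face_maps X s p ->
  @slide_map t (projT1 p) w = @slide_map t s (push (projT2 p) w).
Proof.
have fix_slide e b (z : splx R (star_vtx (StarSigma e b))) :
    retract z = z -> slide t z = z.
  move=> rz; apply: splx_eq => k; rewrite slideE rz; ring.
case: s p w => [s|e b|e] p w h /=; last by case: h.
  by case: h w => q qs <- w /=; exact: hat_cls_face.
case: h w => [[->|->]|[a _ <-]] w /=.
- by apply: star_cls_end; rewrite slideE retractE /= push_out // !mulr0 addr0.
- rewrite fix_slide.
    rewrite /hat_cls (@star_cls_face (StarSigma e b) (star_face
      (t := StarHat (HatHalf e b)) (@half_in_sigma _))) //; by left; right.
  apply: retract_id => j; rewrite excess0.
    by rewrite push_out // => -[].
  by rewrite push_out // => -[].
- rewrite fix_slide.
    rewrite /hat_cls (@star_cls_face (StarSigma e b) (star_face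
     (t := StarHat (page_simplex b a)) (triangle_in_sigma a))) //; by right; exists a.
  have wj j : j != a -> set_val (push (triangle_in_sigma a) w) (Some (Some j)) = 0.
    by move=> ja; rewrite push_out // => -[[]|] // [aj]; rewrite aj eqxx in ja.
  apply: retract_id => j; have [->|ja] := eqVneq j a; last by rewrite excess0 ?wj.
  exact: excess_single.
Qed.

Lemma continuous_clamp : continuous clamp.
Proof.
have ci : continuous (fun t : R => t) by move=> ?; exact: cvg_id.
by rewrite /clamp; rcont.
Qed.

Lemma slide_continuous e b :
  continuous (fun p : splx R (star_vtx (StarSigma e b)) * R => slide p.2 p.1).
Proof.
apply: in_body_continuous => k; rewrite /mix.
have cc : continuous (fun p : splx R (star_vtx (StarSigma e b)) * R => clamp p.2).
  by move=> p; apply: continuous_comp; [exact: cvg_snd|exact: continuous_clamp].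
have cw : continuous (fun p : splx R (star_vtx (StarSigma e b)) * R => set_val p.1 k).
  by apply: continuous_set_type_eval => p; exact: cvg_fst.
have cr : continuous (fun p : splx R (star_vtx (StarSigma e b)) * R =>
    set_val (retract p.1) k).
  apply: continuous_set_type_eval => p.
  apply: (@continuous_comp _ _ _ fst (@retract R _)); first exact: cvg_fst.
  exact: retract_continuous.
by rcont.
Qed.

Lemma slide_map_continuous s :
  continuous (fun p : splx R (star_vtx s) * R => @slide_map p.2 s p.1).
Proof.
case: s => [q|e b|e] /=.
- move=> p; apply: (@continuous_comp _ _ _ fst (@hat_cls q)); first exact: cvg_fst.
  exact: star_cls_continuous.
- move=> p; apply: (@continuous_comp _ _ _ (fun p => slide p.2 p.1)
    (@star_cls (StarSigma e b))); first exact: slide_continuous.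
  exact: star_cls_continuous.
- have cp : continuous (fun p : splx R (star_vtx (StarCommon e)) * R =>
      (push Some p.1 : splx R (star_vtx (StarSigma e false)), p.2)).
    apply: continuous_pair => p; last exact: cvg_snd.
    apply: (@continuous_comp _ _ _ fst (@push R _ _ Some)); first exact: cvg_fst.
    exact: push_continuous.
  move=> p; apply: (@continuous_comp _ _ _ _
    (fun p => star_cls (t := StarSigma e false) (slide (b := false) p.2 p.1)) _ (cp p)).
  apply: (@continuous_comp _ _ _ (fun p => slide p.2 p.1)
    (@star_cls (StarSigma e false))); first exact: slide_continuous.
  exact: star_cls_continuous.
Qed.

Lemma slide_map1 s w : @slide_map 1 s w = star_cls w.
Proof.
have s1 e b (z : splx R (star_vtx (StarSigma e b))) : slide 1 z = z.
  apply: splx_eq => k; rewrite slideE /clamp minxx max_r ?ler01 //; ring.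
case: s w => [q|e b|e] w //=; first by rewrite s1.
rewrite s1 -(@star_cls_face (StarSigma e false) (star_face (t := StarCommon e) Some)) //.
by left; left.
Qed.

Lemma slide_map0 s w : @slide_map 0 s w = star_map hat_cls w.
Proof.
have s0 e b (z : splx R (star_vtx (StarSigma e b))) : slide 0 z = retract z.
  apply: splx_eq => k; rewrite slideE /clamp min_l ?ler01 // maxxx; ring.
by case: s w => [q|e b|e] w //=; rewrite s0 book_hat_cls.
Qed.

(** Naturality in the target: composing with [f] merely replaces the family. With [sq_map_comp] it
    reduces both composites of the equivalence to induced maps of known families. *)
Lemma star_map_comp (U V : topologicalType) (f : U -> V)
    (Phi : forall t : hat_simplex X, splx R (hat_vtx t) -> U)
    (Psi : forall t : hat_simplex X, splx R (hat_vtx t) -> V) :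
  (forall t w, f (Phi t w) = Psi t w) ->
  forall s w, f (@star_map R X U Phi s w) = star_map Psi w.
Proof.
move=> fP; case=> [t|e b|e] w //=; rewrite /book; case: pickP => *; exact: fP.
Qed.

Lemma sq_map_comp (U V : topologicalType) (f : U -> V)
    (Phi : forall t : hat_simplex X, splx R (hat_vtx t) -> U)
    (Psi : forall t : hat_simplex X, splx R (hat_vtx t) -> V) :
  (forall t w, f (Phi t w) = Psi t w) ->
  forall c x, f (@sq_map R X U Phi c x) = sq_map Psi x.
Proof.
move=> fP; case=> [v|e|s] x /=.
- exact: fP.
- by rewrite /edge_map; case: pselect => *; exact: fP.
- by rewrite /square_map; case: ifP => *; exact: fP.
Qed.

Lemma square_simplexification : homotopy_equivalent R SX KX.
Proof.
pose f := sq_lift hat_cls.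
pose g : KX -> SX := star_lift (star_map (@hat_to_sq R X)).
have gE t w : g (@star_cls t w) = star_map (@hat_to_sq R X) w.
  by apply: star_liftE => s p z; apply: star_map_face; exact: hat_to_sq_face.
have fE t w : f (@hat_to_sq R X t w) = @hat_cls t w.
  exact: (sq_lift_hat_to_sq hat_cls_face).
exists f, g; split.
- apply: sq_lift_continuous; first exact: hat_cls_face.
  by move=> t; exact: (@star_cls_continuous (StarHat t)).
- apply: realisation_continuous => t.
  rewrite (_ : (fun x => _) = @star_map R X SX (@hat_to_sq R X) t); last first.
    by apply/funext => w; exact: gE.
  by apply: star_map_continuous; [exact: hat_to_sq_face|exact: hat_to_sq_continuous].
- exists (fun p => p.1); split=> // [|x].
    by apply: continuous_subspaceT => p; exact: cvg_fst.
  apply/esym; move: x; apply: cls_ind => c x /=.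
  rewrite -[cls x]/(sqcls x) /f (sq_liftE hat_cls_face).
  rewrite (sq_map_comp (Psi := @hat_to_sq R X)) => [|t w]; last exact: gE (StarHat t) w.
  exact: sq_map_hat_to_sq.
have HE t s w : star_lift (@slide_map t) (@star_cls s w) = slide_map t w.
  by apply: star_liftE => s' p z; exact: slide_map_face.
exists (fun p => star_lift (@slide_map p.2) p.1); split.
- apply: continuous_subspaceT; apply: realisation_homotopy_continuous => s /=.
  rewrite (_ : (fun p => _) = fun p => @slide_map p.2 s p.1).
    exact: slide_map_continuous.
  by apply/funext => p; exact: HE.
- apply: cls_ind => s w /=; rewrite -[cls w]/(star_cls w) HE slide_map0 gE.
  by rewrite (star_map_comp (Psi := hat_cls)).
- by apply: cls_ind => s w /=; rewrite -[cls w]/(star_cls w) HE slide_map1.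
Qed.

End HomotopyEquivalence.

Theorem proposition2p2 (R : realType) (X : vh_complex)
  (hfin : forall e : edge X, vertical e ->
     finite_set [set s : square X | exists d b, side s d b = e]) :
  homotopy_equivalent R
    (realisation (sq_gluing R X))
    (realisation (simp_gluing R (simplexification X))).
Proof. exact: square_simplexification. Qed.
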